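(* For real $u\ge4$, with $y=1/(u-2)$, $$P_4(u)=P_3(u-1)\log(u)+\frac{\zeta_2}{4}\left(2\,\mathrm{Li}_2\!\left(1-\frac1u\right)+\log^2(u)\right)-E_4(y)-H_4(y).$$
   Context: The functions $P_k$ are defined by $P_0(u)=1$ for $u\ge 0$, and for integers $k\ge1$, $P_k:[k,\infty)\to\mathbb{R}$ is the function with $P_k(k)=0$ and $uP_k'(u)=P_{k-1}(u-1)$ for $u\ge k$. $\mathrm{Li}_k(z)=\sum_{n\ge1}z^n/n^k$ for $|z|\le1$, so $\mathrm{Li}_1(z)=-\log(1-z)$, and $\zeta_k=\mathrm{Li}_k(1)$. For $0<y\le\frac12$ define $$E_4(y)=\tfrac{19}{16}\zeta_4-3\,\mathrm{Li}_4(-y)+3\,\mathrm{Li}_3(-y)\log(y)-\tfrac32\,\mathrm{Li}_2(-y)\log^2(y)+\tfrac12\,\mathrm{Li}_1(-y)\log^3(y)+\tfrac18\log^4(y),$$ $$H_4(y)=\int_0^y\left(\log\!\left(\frac{x}{1+2x}\right)\mathrm{Li}_2(x)+\frac12\log^2(x)\,\mathrm{Li}_1(-2x)\right)\frac{dx}{x(1+x)}.$$ *)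

(* Defs.v *)
From Stdlib Require Import Reals.
From Coquelicot Require Import Coquelicot.
Open Scope R_scope.

(* P_0(u) = 1; P_k(u) = int_k^u P_{k-1}(t-1) dt/t for u >= k, which is the
   unique function on [k,oo) with P_k(k) = 0 and u P_k'(u) = P_{k-1}(u-1).
   (Values for u < k are irrelevant junk.) *)
Fixpoint P (k : nat) (u : R) : R :=
  match k with
  | O => 1
  | S j => RInt (fun t => P j (t - 1) / t) (INR (S j)) u
  end.

Definition Li (k : nat) (z : R) : R :=
  Series (fun n => z ^ (S n) / (INR (S n)) ^ k).

Definition zeta (k : nat) : R := Li k 1.

Definition E4 (y : R) : R :=
  19 / 16 * zeta 4 - 3 * Li 4 (- y) + 3 * Li 3 (- y) * ln y
  - 3 / 2 * Li 2 (- y) * (ln y) ^ 2 + 1 / 2 * Li 1 (- y) * (ln y) ^ 3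
  + 1 / 8 * (ln y) ^ 4.

(* The integrand has an integrable log-singularity at 0, so the integral
   is the improper Riemann integral from 0+ to y. *)
Definition H4_integrand (x : R) : R :=
  (ln (x / (1 + 2 * x)) * Li 2 x + 1 / 2 * (ln x) ^ 2 * Li 1 (- (2 * x)))
  / (x * (1 + x)).

Definition H4 (y : R) : R :=
  RInt_gen H4_integrand (at_right 0) (at_point y).

(* Main.v *)
Require Import Defs.
From Stdlib Require Import Reals Lra Lia ZArith.
From Coquelicot Require Import Coquelicot.
Open Scope R_scope.

(* With [H4] rewritten as the integral of a function smooth on (0, 1), both sides of the
   identity are differentiable for u > 3, and the closed form
   P_2(v) = (log v)^2 / 2 + Li_2(1/v) - zeta_2 / 2 shows that their derivatives agree.
   The remaining constant is found by letting u tend to infinity.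

   For P_k(n) with n a large integer, P_k is squeezed between discrete analogues: the sums
   of 1/(k! m_1 ... m_k) over integers m_i >= n (or > n) with m_1 + ... + m_k <= n^2.
   Without the lower cutoff (m_i >= 1) such a sum is exactly the elementary symmetric
   function e_k(1, 1/2, ..., 1/N), because exp (w sum x^m / m) / (1 - x) = (1 - x)^(-1-w).
   Raising the cutoff from n to n + 1 multiplies the generating series by
   exp (- w x^n / n), whose effect, up to small errors, is to replace the power sum p_1 by
   p_1 - 1/n in Newton's formula for e_k. Hence, with L = log n and
   P_4(n) ~ L^4/24 - zeta_2 L^2/4 + zeta_3 L/3 + zeta_2^2/8 - zeta_4/4 (similarly for P_3),
   the constant vanishes by zeta_2^2 = (5/2) zeta_4. *)

(** * Polylogarithms inside the unit disc *)

(** The constant is sought at infinity because at u = 4 both P-values vanish but the integral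
    H_4(1/2) itself remains, whereas H_4(y) tends to 0 with y. The price is that the constant term
    of P_4 must be known.

    In P_4(n) - P_3(n-1) log n the zeta_3 terms cancel. The growing terms left, -L^4/8 and zeta_2
    L^2/4, are matched by log^4(y)/8 in E_4 and by the term zeta_2 log^2(u)/4 of the identity.

    The size n^2 balances two errors. Reading P_k(N/n) as a Riemann sum of mesh 1/n costs a relative
    error of order 1/n. Newton's formula with cutoff n is off by about n/N times a power of log N,
    since each raising of the cutoff also shifts the argument by multiples of n. With N = n^2 both
    are O(log^4 n / n), which survives the multiplication of P_3 by log n, and the sampled point N/n
    is n. Integer points suffice because the difference of the two sides has derivative 0.

    Errors made of powers of log n over n are all weakened to c sqrt(1/n), so that limits follow
    from explicit inequalities; the numerical constants are generous. *)

Definition coefLi (k n : nat) : R := / INR (S n) ^ k.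

Lemma Li_PSeries (k : nat) (z : R) : Li k z = z * PSeries (coefLi k) z.
Proof.
  unfold Li, PSeries. rewrite <- Series_scal_l. apply Series_ext. intros n.
  unfold coefLi. simpl pow. unfold Rdiv. ring.
Qed.

Lemma INR_S_ge1 (n : nat) : 1 <= INR (S n).
Proof. rewrite S_INR. pose proof (pos_INR n). lra. Qed.

Lemma coefLi_bounds (k n : nat) : 0 < coefLi k n <= 1.
Proof.
  unfold coefLi. pose proof (INR_S_ge1 n) as H.
  assert (1 <= INR (S n) ^ k) by (apply pow_R1_Rle; lra).
  split. apply Rinv_0_lt_compat; lra.
  rewrite <- Rinv_1. apply Rinv_le_contravar; lra.
Qed.

Lemma CV_radius_coefLi (k : nat) (z : R) :
  Rabs z < 1 -> Rbar_lt (Finite (Rabs z)) (CV_radius (coefLi k)).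
Proof.
  intros Hz. destruct (CV_radius_bounded (coefLi k)) as [H _].
  apply Rbar_lt_le_trans with (Finite 1). exact Hz.
  apply H. exists 1. intros n. rewrite pow1, Rmult_1_r.
  pose proof (coefLi_bounds k n). rewrite Rabs_pos_eq; lra.
Qed.

(** Here Li_k(z)/z is written as a power series so that z = 0 is included; [Li_1] compares z with
    the base point 0 and needs the derivative there. *)
Lemma is_derive_Li_PSeries (k : nat) (z : R) :
  Rabs z < 1 -> is_derive (Li (S k)) z (PSeries (coefLi k) z).
Proof.
  intros Hz.
  apply is_derive_ext with (PSeries (PS_incr_1 (coefLi (S k)))).
  { intros t. rewrite PSeries_incr_1, Li_PSeries. reflexivity. }
  replace (PSeries (coefLi k) z)
    with (PSeries (PS_derive (PS_incr_1 (coefLi (S k)))) z).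
  { apply is_derive_PSeries. rewrite CV_radius_incr_1. now apply CV_radius_coefLi. }
  apply PSeries_ext. intros n. unfold PS_derive, PS_incr_1, coefLi.
  pose proof (INR_S_ge1 n). rewrite <- tech_pow_Rmult. field.
  split. apply pow_nonzero; lra. lra.
Qed.

Lemma is_derive_Li (k : nat) (z : R) :
  Rabs z < 1 -> z <> 0 -> is_derive (Li (S k)) z (Li k z / z).
Proof.
  intros Hz H0. rewrite Li_PSeries.
  replace (z * PSeries (coefLi k) z / z) with (PSeries (coefLi k) z) by (field; lra).
  now apply is_derive_Li_PSeries.
Qed.

Lemma Li_0_arg (k : nat) : Li k 0 = 0.
Proof. rewrite Li_PSeries. ring. Qed.

Lemma PSeries_coefLi_0 (z : R) : Rabs z < 1 -> PSeries (coefLi 0) z = / (1 - z).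
Proof.
  intros Hz. unfold PSeries. rewrite <- (Series_geom z Hz).
  apply Series_ext. intros n. unfold coefLi. simpl. field.
Qed.

Lemma is_derive_Li_1 (z : R) : Rabs z < 1 -> is_derive (Li 1) z (/ (1 - z)).
Proof.
  intros Hz. rewrite <- PSeries_coefLi_0 by exact Hz. now apply is_derive_Li_PSeries.
Qed.

Lemma derive_zero_eq (f : R -> R) (a b : R) :
  (forall t, Rmin a b <= t <= Rmax a b -> is_derive f t 0) -> f a = f b.
Proof.
  intros H. destruct (Rtotal_order a b) as [L|[E|L]].
  - apply eq_is_derive; [|exact L]. intros t Ht. apply H.
    rewrite Rmin_left, Rmax_right; lra.
  - now rewrite E.
  - symmetry. apply eq_is_derive; [|exact L]. intros t Ht. apply H.
    rewrite Rmin_right, Rmax_left; lra.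
Qed.

Lemma Li_1 (z : R) : Rabs z < 1 -> Li 1 z = - ln (1 - z).
Proof.
  intros Hz.
  cut (Li 1 z + ln (1 - z) = Li 1 0 + ln (1 - 0)).
  { rewrite Li_0_arg, Rminus_0_r, ln_1. lra. }
  apply Rabs_def2 in Hz.
  apply (derive_zero_eq (fun t => Li 1 t + ln (1 - t))).
  intros t Ht.
  assert (Hlt : Rabs t < 1).
  { apply Rabs_def1; destruct (Rle_dec z 0);
      [rewrite Rmax_right in Ht|rewrite Rmax_left in Ht|
       rewrite Rmin_left in Ht|rewrite Rmin_right in Ht]; lra. }
  pose proof (Rabs_def2 _ _ Hlt).
  pose proof (is_derive_Li_1 t Hlt) as HD.
  auto_derive.
  - repeat split. now exists (/ (1 - t)). lra.
  - rewrite (is_derive_unique _ _ _ HD : Derive (fun x => Li 1 x) t = _). field. lra.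
Qed.

(** All coefficients lie in (0, 1], so |Li_k(z)/z| is at most the geometric sum 1/(1 - |z|) <= 2,
    whatever k is. *)
Lemma Li_linear_bound (k : nat) (z : R) : Rabs z <= 1 / 2 -> Rabs (Li k z) <= 2 * Rabs z.
Proof.
  intros Hz. rewrite Li_PSeries, Rabs_mult, Rmult_comm.
  apply Rmult_le_compat_r. apply Rabs_pos.
  assert (Hg : is_series (fun n => Rabs z ^ n) (/ (1 - Rabs z))).
  { apply is_series_geom. rewrite Rabs_Rabsolu. lra. }
  assert (Hle : forall n, 0 <= Rabs (coefLi k n * z ^ n) <= Rabs z ^ n).
  { intros n. split. apply Rabs_pos. rewrite Rabs_mult, RPow_abs.
    pose proof (coefLi_bounds k n). rewrite (Rabs_pos_eq (coefLi k n)) by lra.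
    pose proof (Rabs_pos (z ^ n)). nra. }
  unfold PSeries.
  eapply Rle_trans. apply Series_Rabs.
  { apply (ex_series_le (V := R_CompleteNormedModule)) with (fun n => Rabs z ^ n). intros n.
    change norm with Rabs. rewrite Rabs_Rabsolu. apply Hle.
    now exists (/ (1 - Rabs z)). }
  apply Rle_trans with (Series (fun n => Rabs z ^ n)).
  { apply Series_le. exact Hle. now exists (/ (1 - Rabs z)). }
  rewrite (is_series_unique (fun n => Rabs z ^ n) _ Hg).
  replace 2 with (/ (1 / 2)) by field.
  apply Rinv_le_contravar; lra.
Qed.

(** * Finite sums and zeta values *)

Fixpoint sum1 (f : nat -> R) (N : nat) : R :=
  match N with O => 0 | S M => sum1 f M + f (S M) end.

Lemma sum_n_sum1 (f : nat -> R) (N : nat) : sum_n (fun n => f (S n)) N = sum1 f (S N).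
Proof.
  induction N as [|N IH].
  - rewrite sum_O. cbn [sum1]. now rewrite Rplus_0_l.
  - rewrite sum_Sn, IH. reflexivity.
Qed.

Lemma sum1_ext (f g : nat -> R) (N : nat) :
  (forall m, (1 <= m <= N)%nat -> f m = g m) -> sum1 f N = sum1 g N.
Proof.
  induction N as [|N IH]; intros H. reflexivity.
  cbn [sum1]. rewrite IH. rewrite H by lia. reflexivity. intros m Hm. apply H. lia.
Qed.

Lemma sum1_plus (f g : nat -> R) (N : nat) :
  sum1 (fun m => f m + g m) N = sum1 f N + sum1 g N.
Proof. induction N as [|N IH]; cbn [sum1]. ring. rewrite IH. ring. Qed.

Lemma sum1_scal (c : R) (f : nat -> R) (N : nat) :
  sum1 (fun m => c * f m) N = c * sum1 f N.
Proof. induction N as [|N IH]; cbn [sum1]. ring. rewrite IH. ring. Qed.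

Lemma sum1_le (f g : nat -> R) (N : nat) :
  (forall m, (1 <= m <= N)%nat -> f m <= g m) -> sum1 f N <= sum1 g N.
Proof.
  induction N as [|N IH]; intros H. simpl; lra.
  cbn [sum1]. apply Rplus_le_compat. apply IH. intros m Hm. apply H. lia. apply H. lia.
Qed.

Lemma sum1_const (c : R) (N : nat) : sum1 (fun _ => c) N = INR N * c.
Proof. induction N as [|N IH]; cbn [sum1]. simpl; ring. rewrite IH, S_INR. ring. Qed.

Lemma sum1_add (f : nat -> R) (N M : nat) :
  sum1 f (N + M) = sum1 f N + sum1 (fun m => f (N + m)%nat) M.
Proof.
  induction M as [|M IH]; cbn [sum1]. rewrite Nat.add_0_r. ring.
  rewrite Nat.add_succ_r. cbn [sum1]. rewrite IH. ring.
Qed.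

Lemma sum1_prod (f g : nat -> R) (N M : nat) :
  sum1 f N * sum1 g M = sum1 (fun m => sum1 (fun n => f m * g n) M) N.
Proof.
  induction N as [|N IH]; cbn [sum1]. ring.
  rewrite <- IH, sum1_scal. ring.
Qed.

Lemma sum1_swap (f : nat -> nat -> R) (N M : nat) :
  sum1 (fun m => sum1 (fun n => f m n) M) N = sum1 (fun n => sum1 (fun m => f m n) N) M.
Proof.
  induction N as [|N IH]; cbn [sum1].
  - rewrite sum1_const. ring.
  - rewrite IH, <- sum1_plus. reflexivity.
Qed.

(** A square splits into its diagonal and two mirror halves; the difference of the two inner sums is
    the half n < m <= K. *)
Lemma sum1_square_sym (f : nat -> nat -> R) (K : nat) :
  (forall m n, f m n = f n m) ->
  sum1 (fun m => sum1 (fun n => f m n) K) K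
  = sum1 (fun n => 2 * (sum1 (fun m => f m n) K - sum1 (fun m => f m n) n) + f n n) K.
Proof.
  intros Hs.
  assert (H : forall M, sum1 (fun m => sum1 (fun n => f m n) M) M
     = sum1 (fun n => 2 * (sum1 (fun m => f m n) M - sum1 (fun m => f m n) n) + f n n) M).
  { induction M as [|M IH]. reflexivity.
    cbn [sum1]. rewrite sum1_plus, IH.
    rewrite (sum1_ext (fun n => 2 * (sum1 (fun m => f m n) M + f (S M) n
                - sum1 (fun m => f m n) n) + f n n)
       (fun n => (2 * (sum1 (fun m => f m n) M - sum1 (fun m => f m n) n) + f n n)
          + 2 * f (S M) n)) by (intros; ring).
    rewrite !sum1_plus, !sum1_scal.
    rewrite (sum1_ext (fun n => f n (S M)) (fun n => f (S M) n)) by (intros; apply Hs).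
    change (sum1 (f (S M)) M) with (sum1 (fun n => f (S M) n) M). ring. }
  apply H.
Qed.

Lemma sum1_nonneg_le (f : nat -> R) (N M : nat) :
  (forall m, 0 <= f m) -> (N <= M)%nat -> sum1 f N <= sum1 f M.
Proof.
  intros Hf H. induction H as [|M H IH]. lra. cbn [sum1]. specialize (Hf (S M)). lra.
Qed.

Lemma inv_INR_nonneg (m : nat) : 0 <= / INR m.
Proof.
  destruct m as [|m]. simpl; rewrite Rinv_0; lra.
  apply Rlt_le, Rinv_0_lt_compat. pose proof (INR_S_ge1 m). lra.
Qed.

Definition psum (j N : nat) : R := sum1 (fun m => / INR m ^ j) N.

Lemma psum_incr (k N : nat) : psum k N <= psum k (S N).
Proof.
  unfold psum. cbn [sum1].
  assert (0 < / INR (S N) ^ k) by apply coefLi_bounds. lra.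
Qed.

Lemma psum_pos (k N : nat) : 0 <= psum k N.
Proof.
  induction N. unfold psum; simpl; lra. eapply Rle_trans; [|apply psum_incr]. exact IHN.
Qed.

(** Since 1/(x+1)^2 <= 1/x - 1/(x+1), the partial sum plus 1/N decreases in N while the partial sum
    itself increases; the two enclose [zeta k] with gap 1/N. *)
Lemma psum_2_tail (k N : nat) : (2 <= k)%nat ->
  psum k (S (S N)) + / INR (S (S N)) <= psum k (S N) + / INR (S N).
Proof.
  intros Hk. unfold psum. cbn [sum1].
  pose proof (INR_S_ge1 N) as H. rewrite (S_INR (S N)).
  set (x := INR (S N)) in *.
  assert (/ (x + 1) ^ k <= / (x + 1) ^ 2).
  { apply Rinv_le_contravar. nra. apply Rle_pow; [lra|lia]. }
  assert (/ (x + 1) ^ 2 + / (x + 1) <= / x).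
  { apply Rmult_le_reg_r with ((x + 1) ^ 2 * x). nra.
    replace ((/ (x + 1) ^ 2 + / (x + 1)) * ((x + 1) ^ 2 * x)) with (x + (x + 1) * x)
      by (field; lra).
    replace (/ x * ((x + 1) ^ 2 * x)) with ((x + 1) ^ 2) by (field; lra). nra. }
  lra.
Qed.

Lemma psum_2_tail_le (k N M : nat) : (2 <= k)%nat -> (1 <= N <= M)%nat ->
  psum k M + / INR M <= psum k N + / INR N.
Proof.
  intros Hk [H1 H2]. induction H2 as [|M H2 IH]. lra.
  destruct M as [|M]. lia.
  eapply Rle_trans. apply psum_2_tail. exact Hk. exact IH.
Qed.

Lemma psum_le_2 (k N : nat) : (2 <= k)%nat -> psum k N <= 2.
Proof.
  intros Hk. destruct N as [|N]. unfold psum; simpl; lra.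
  pose proof (psum_2_tail_le k 1 (S N) Hk ltac:(lia)) as H.
  unfold psum at 2 in H. cbn [sum1] in H. simpl (INR 1) in H.
  rewrite pow1, Rinv_1 in H.
  assert (0 < / INR (S N)) by (apply Rinv_0_lt_compat; pose proof (INR_S_ge1 N); lra). lra.
Qed.

Lemma psum_lim (k : nat) : (2 <= k)%nat ->
  ex_series (fun n => 1 ^ S n / INR (S n) ^ k) /\ is_lim_seq (psum k) (zeta k).
Proof.
  intros Hk.
  assert (Hs : ex_series (fun n => 1 ^ S n / INR (S n) ^ k)).
  { destruct (ex_finite_lim_seq_incr (fun N => psum k (S N)) 2) as [l Hl].
    intros n. apply psum_incr. intros n. now apply psum_le_2.
    exists l. unfold is_series. apply is_lim_seq_ext with (2 := Hl).
    intros n. unfold psum. rewrite <- (sum_n_sum1 (fun m => / INR m ^ k)).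
    apply sum_n_ext. intros m. rewrite pow1. unfold Rdiv. now rewrite Rmult_1_l. }
  split. exact Hs.
  apply is_lim_seq_incr_1.
  apply is_lim_seq_ext with (sum_n (fun n => 1 ^ S n / INR (S n) ^ k)).
  { intros n. unfold psum. rewrite <- (sum_n_sum1 (fun m => / INR m ^ k)).
    apply sum_n_ext. intros m. rewrite pow1. unfold Rdiv. now rewrite Rmult_1_l. }
  apply Series_correct. exact Hs.
Qed.

Lemma psum_zeta (k N : nat) : (2 <= k)%nat -> (1 <= N)%nat ->
  psum k N <= zeta k <= psum k N + / INR N.
Proof.
  intros Hk HN. destruct (psum_lim k Hk) as [_ Hl]. split.
  - apply (is_lim_seq_le_loc (fun _ => psum k N) (psum k) (psum k N) (zeta k)).
    exists N. intros n Hn. induction Hn. lra. eapply Rle_trans. exact IHHn. apply psum_incr.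
    apply is_lim_seq_const. exact Hl.
  - apply (is_lim_seq_le_loc (psum k) (fun _ => psum k N + / INR N) (zeta k) (psum k N + / INR N)).
    exists N. intros n Hn.
    pose proof (psum_2_tail_le k N n Hk ltac:(lia)).
    assert (0 < / INR n) by (apply Rinv_0_lt_compat, lt_0_INR; lia). lra.
    exact Hl. apply is_lim_seq_const.
Qed.

(** * The relation 2 zeta_2^2 = 5 zeta_4 *)

(* Zagier: f(m,n) - f(m+n,n) - f(m,m+n) = 2/(m^2 n^2), so summing over all m, n leaves the diagonal 5/n^4. *)
Definition zagier (m n : nat) : R :=
  2 * / (INR m ^ 3 * INR n) + / (INR m ^ 2 * INR n ^ 2) + 2 * / (INR m * INR n ^ 3).

Lemma zagier_sym (m n : nat) : zagier m n = zagier n m.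
Proof.
  unfold zagier. rewrite (Rmult_comm (INR n ^ 3)), (Rmult_comm (INR n ^ 2)),
    (Rmult_comm (INR n)). ring.
Qed.

Lemma zagier_rel (m n : nat) : (1 <= m)%nat -> (1 <= n)%nat ->
  zagier m n - zagier (n + m) n - zagier (m + n) m = 2 * (/ INR m ^ 2 * / INR n ^ 2).
Proof.
  intros Hm Hn. unfold zagier. rewrite !plus_INR.
  apply lt_0_INR in Hm. apply lt_0_INR in Hn. field. lra.
Qed.

(** Finite form of the telescoping. In f(n+m, n) with m <= K the first index runs over (n, K+n]. The
    part up to K is one off-diagonal half of the sum of f, so the two shifted sums cancel both
    halves; the diagonal and the part in (K, K+n] remain. *)
Lemma psum_2_square (K : nat) :
  2 * psum 2 K ^ 2
  = 5 * psum 4 K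
    - 2 * sum1 (fun n => sum1 (fun m => zagier (K + m) n) n) K.
Proof.
  replace (2 * psum 2 K ^ 2)
    with (sum1 (fun m => sum1 (fun n =>
            zagier m n + (- (1)) * zagier (n + m) n + (- (1)) * zagier (m + n) m) K) K).
  2:{ replace (2 * psum 2 K ^ 2) with (2 * (psum 2 K * psum 2 K)) by ring.
      unfold psum. rewrite sum1_prod, <- sum1_scal. apply sum1_ext. intros m Hm.
      rewrite <- sum1_scal. apply sum1_ext. intros n Hn.
      rewrite <- zagier_rel by lia. ring. }
  rewrite (sum1_ext _ (fun m => sum1 (fun n => zagier m n) K
     + (- (1)) * sum1 (fun n => zagier (n + m) n) K
     + (- (1)) * sum1 (fun n => zagier (m + n) m) K)).
  2:{ intros m _. rewrite !sum1_plus, !sum1_scal. reflexivity. }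
  rewrite !sum1_plus, !sum1_scal.
  rewrite (sum1_swap (fun m n => zagier (n + m) n)).
  rewrite sum1_square_sym by apply zagier_sym.
  assert (H : forall n, sum1 (fun m => zagier (n + m) n) K
     = (sum1 (fun m => zagier m n) K - sum1 (fun m => zagier m n) n)
       + sum1 (fun m => zagier (K + m) n) n).
  { intros n. pose proof (sum1_add (fun m => zagier m n) n K) as H1.
    pose proof (sum1_add (fun m => zagier m n) K n) as H2.
    rewrite Nat.add_comm in H2. lra. }
  rewrite (sum1_ext (fun n => sum1 (fun m => zagier (n + m) n) K) _ K (fun n _ => H n)).
  unfold psum. rewrite <- (sum1_scal 5).
  rewrite !sum1_plus, !sum1_scal.
  rewrite (sum1_ext (fun n => zagier n n) (fun n => 5 * / INR n ^ 4)).
  2:{ intros n [Hn _]. unfold zagier. apply lt_0_INR in Hn. field. lra. }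
  rewrite sum1_scal. ring.
Qed.

(** As the first index exceeds K, each term is at most (1/n)(3/K^2 + 2/(K n^2)). The n values of m
    absorb the 1/n, and the sum over n is at most 3/K + (2/K) 2. *)
Lemma zagier_remainder (K : nat) : (1 <= K)%nat ->
  0 <= sum1 (fun n => sum1 (fun m => zagier (K + m) n) n) K <= 7 / INR K.
Proof.
  intros HK. pose proof HK as HK0. apply lt_0_INR in HK0. set (x := INR K) in *.
  assert (Hb : forall n m, (1 <= n <= K)%nat -> (1 <= m)%nat ->
    0 <= zagier (K + m) n <= / INR n * (3 / x ^ 2 + 2 * / x * / INR n ^ 2)).
  { intros n m Hn Hm. unfold zagier. rewrite plus_INR. fold x.
    assert (Hn0 : 1 <= INR n) by (apply (le_INR 1); lia).
    assert (Hnx : INR n <= x) by (apply le_INR; lia).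
    assert (Hm0 : 0 <= INR m) by apply pos_INR.
    set (a := INR n) in *. set (b := x + INR m).
    assert (Hbx : x <= b) by (unfold b; lra).
    assert (Hib : 0 < / b <= / x).
    { split. apply Rinv_0_lt_compat; lra. apply Rinv_le_contravar; lra. }
    assert (Hia : 0 < / a <= 1).
    { split. apply Rinv_0_lt_compat; lra. rewrite <- Rinv_1. apply Rinv_le_contravar; lra. }
    replace (2 * / (b ^ 3 * a) + / (b ^ 2 * a ^ 2) + 2 * / (b * a ^ 3))
      with (/ a * (2 * (/ b) ^ 2 * / b + (/ b) ^ 2 * / a + 2 * / b * (/ a) ^ 2)) by (field; lra).
    replace (/ a * (3 / x ^ 2 + 2 * / x * / a ^ 2))
      with (/ a * (2 * (/ x) ^ 2 * 1 + (/ x) ^ 2 * 1 + 2 * / x * (/ a) ^ 2)) by (field; lra).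
    assert (Hx1 : / x <= 1) by (rewrite <- Rinv_1; apply Rinv_le_contravar; lra).
    assert ((/ b) ^ 2 <= (/ x) ^ 2) by (apply pow_incr; lra).
    assert (0 < (/ b) ^ 2) by (apply pow_lt; lra).
    assert (0 < (/ a) ^ 2) by (apply pow_lt; lra).
    split. apply Rmult_le_pos. lra. nra.
    apply Rmult_le_compat_l. lra.
    repeat apply Rplus_le_compat; [nra|nra|nra]. }
  split.
  - rewrite <- (Rmult_0_r (INR K)), <- sum1_const. apply sum1_le. intros n Hn.
    rewrite <- (Rmult_0_r (INR n)), <- sum1_const. apply sum1_le. intros m Hm.
    apply Hb; lia.
  - apply Rle_trans with (sum1 (fun n => 3 / x ^ 2 + 2 * / x * / INR n ^ 2) K).
    + apply sum1_le. intros n Hn.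
      apply Rle_trans with (sum1 (fun _ => / INR n * (3 / x ^ 2 + 2 * / x * / INR n ^ 2)) n).
      apply sum1_le. intros m Hm. apply Hb; lia.
      rewrite sum1_const, <- Rmult_assoc, Rinv_r, Rmult_1_l. lra.
      apply not_0_INR. lia.
    + rewrite sum1_plus, sum1_const, sum1_scal. fold (psum 2 K). fold x.
      pose proof (psum_le_2 2 K ltac:(lia)) as H2.
      assert (0 < / x) by (apply Rinv_0_lt_compat; lra).
      replace (7 / x) with (x * (3 / x ^ 2) + 2 * / x * 2) by (field; lra). nra.
Qed.

Lemma zeta_2_square : zeta 2 ^ 2 = 5 / 2 * zeta 4.
Proof.
  assert (H2 := proj2 (psum_lim 2 ltac:(lia))).
  assert (H4 := proj2 (psum_lim 4 ltac:(lia))).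
  assert (L : is_lim_seq (fun K => 5 * psum 4 K - 2 * (psum 2 K * psum 2 K)) (5 * zeta 4 - 2 * (zeta 2 * zeta 2))).
  { apply is_lim_seq_minus'.
    apply (is_lim_seq_scal_l _ 5 (zeta 4)). exact H4.
    apply (is_lim_seq_scal_l _ 2 (zeta 2 * zeta 2)). apply is_lim_seq_mult'; exact H2. }
  assert (L0 : is_lim_seq (fun K => 5 * psum 4 K - 2 * (psum 2 K * psum 2 K)) 0).
  { apply is_lim_seq_le_le_loc with (fun _ => 0) (fun K => 14 * / INR K).
    - exists 1%nat. intros K HK. pose proof (psum_2_square K).
      pose proof (zagier_remainder K HK). unfold Rdiv in *. lra.
    - apply is_lim_seq_const.
    - replace (Finite 0) with (Rbar_mult 14 (Rbar_inv p_infty)) by (simpl; f_equal; ring).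
      apply is_lim_seq_scal_l. apply is_lim_seq_inv. apply is_lim_seq_INR. discriminate. }
  apply is_lim_seq_unique in L. apply is_lim_seq_unique in L0.
  rewrite L in L0. injection L0. lra.
Qed.

(** * Multiple harmonic sums with a lower cutoff *)

(* [rough n k z] is the sum of [1 / (k! m_1 ... m_k)] over all integers [m_i >= n] with
   [m_1 + ... + m_k <= z], i.e. the coefficient of [w^k x^z] in
   [exp (w * sum_(m >= n) x^m / m) / (1 - x)]; the recurrence is the logarithmic
   derivative of this series in [x]. *)
Fixpoint rough (n k : nat) (z : Z) : R :=
  match k with
  | O => if (z <? 0)%Z then 0 else 1
  | S j => sum1 (fun m => rough n j (Z.of_nat m - Z.of_nat n) / INR m) (Z.to_nat z)
  end.

Lemma rough_neg (n k : nat) (z : Z) : (z < 0)%Z -> rough n k z = 0.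
Proof.
  intros Hz. destruct k as [|k]; simpl.
  - apply Z.ltb_lt in Hz. now rewrite Hz.
  - now replace (Z.to_nat z) with O by lia.
Qed.

Lemma rough_S_nonpos (n k : nat) (z : Z) : (z <= 0)%Z -> rough n (S k) z = 0.
Proof. intros Hz. simpl. now replace (Z.to_nat z) with O by lia. Qed.

(** For the generating series F, the product (1 - x) F is an exponential and x d/dx((1 - x) F) = w
    x^n F; the coefficients of w^(k+1) x^z are compared. Integer arguments with value 0 below 0
    spare the later shifts any boundary case. *)
Lemma rough_step (n k : nat) (z : Z) : (1 <= n)%nat ->
  IZR z * (rough n (S k) z - rough n (S k) (z - 1)) = rough n k (z - Z.of_nat n).
Proof.
  intros Hn. destruct (Z_le_gt_dec z 0) as [Hz|Hz].
  - rewrite !rough_S_nonpos, (rough_neg n k) by lia. ring.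
  - cbn [rough]. replace (Z.to_nat z) with (S (Z.to_nat (z - 1))) by lia.
    cbn [sum1]. replace (INR (S (Z.to_nat (z - 1)))) with (IZR z)
      by (rewrite INR_IZR_INZ; f_equal; lia).
    replace (Z.of_nat (S (Z.to_nat (z - 1)))) with z by lia.
    field. apply not_0_IZR. lia.
Qed.

(** For z > 0 the factor z cancels, so the weighted differences determine a function from its values
    at z <= 0. This is how identities between generating series are proved coefficientwise. *)
Lemma step_ext (f g : Z -> R) :
  (forall z, (z <= 0)%Z -> f z = g z) ->
  (forall z, IZR z * (f z - f (z - 1)%Z) = IZR z * (g z - g (z - 1)%Z)) ->
  forall z, f z = g z.
Proof.
  intros H0 H z. destruct (Z_le_gt_dec z 0) as [Hz|Hz]. now apply H0.
  assert (Hall : forall m, f (Z.of_nat m) = g (Z.of_nat m)).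
  { induction m as [|m IH]. now apply H0.
    specialize (H (Z.of_nat (S m))).
    replace (Z.of_nat (S m) - 1)%Z with (Z.of_nat m) in H by lia.
    apply Rmult_eq_reg_l in H. lra. apply not_0_IZR. lia. }
  specialize (Hall (Z.to_nat z)). now rewrite Z2Nat.id in Hall by lia.
Qed.

(** The coefficient of w^j x^(jn) in exp(- w x^n / n). *)
Definition ecoef (n j : nat) : R := (- / INR n) ^ j / INR (fact j).

Lemma ecoef_step (n j : nat) : (1 <= n)%nat ->
  ecoef n (S j) * (INR (S j) * INR n) = - ecoef n j.
Proof.
  intros Hn. apply lt_0_INR in Hn. unfold ecoef.
  rewrite fact_simpl, mult_INR. cbn [pow].
  pose proof (INR_fact_neq_0 j). pose proof (INR_S_ge1 j). field. lra.
Qed.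

Lemma rough_0_step (n : nat) (z : Z) : IZR z * (rough n 0 z - rough n 0 (z - 1)) = 0.
Proof.
  simpl. destruct (Z.ltb_spec z 0), (Z.ltb_spec (z - 1) 0); try lia; try ring.
  replace z with 0%Z by lia. ring.
Qed.

(* Coefficientwise form of multiplying the generating series by [exp (- w x^n / n)]. *)
Lemma rough_cutoff (n k : nat) (z : Z) : (1 <= n)%nat ->
  rough (S n) k z
  = sum_f_R0 (fun j => ecoef n j * rough n (k - j) (z - Z.of_nat (j * n))) k.
Proof.
  intros Hn. revert z. induction k as [|k IH]; intros z.
  - cbn [sum_f_R0]. unfold ecoef. simpl. rewrite Z.sub_0_r. field.
  - revert z. apply step_ext.
    + intros z Hz. rewrite rough_S_nonpos by exact Hz. symmetry.
      rewrite decomp_sum by lia. simpl (pred (S k)).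
      rewrite (sum_eq _ (fun _ => 0)).
      2:{ intros j Hj. rewrite (rough_neg n (S k - S j)) by nia. ring. }
      rewrite sum_cte, Nat.sub_0_r. rewrite rough_S_nonpos by lia. ring.
    + intros z. rewrite rough_step, IH by lia.
      rewrite <- minus_sum, scal_sum. symmetry.
      set (N := Z.of_nat n).
      (* Split z = (z - jn) + jn. The first part is what [rough_step] consumes at the shifted
         argument; the second turns the coefficient of index j + 1 into minus that of index j, after
         reindexing. One of its two terms cancels, the other has the argument z - (n + 1) - jn of
         the induction hypothesis. *)
      rewrite (sum_eq _ (fun j =>
         ecoef n j * (IZR (z - Z.of_nat (j * n)) *
            (rough n (S k - j) (z - Z.of_nat (j * n))
             - rough n (S k - j) (z - Z.of_nat (j * n) - 1)))
         + ecoef n j * (INR j * INR n) *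
            (rough n (S k - j) (z - Z.of_nat (j * n))
             - rough n (S k - j) (z - Z.of_nat (j * n) - 1)))).
      2:{ intros j _. rewrite minus_IZR, <- INR_IZR_INZ, mult_INR.
          replace (z - 1 - Z.of_nat (j * n))%Z with (z - Z.of_nat (j * n) - 1)%Z by lia. ring. }
      rewrite sum_plus.
      rewrite tech5. rewrite Nat.sub_diag, rough_0_step, Rmult_0_r, Rplus_0_r.
      rewrite (decomp_sum (fun j => ecoef n j * (INR j * INR n) *
            (rough n (S k - j) (z - Z.of_nat (j * n))
             - rough n (S k - j) (z - Z.of_nat (j * n) - 1))) (S k)) by lia.
      cbn [INR pred]. rewrite Rmult_0_l, Rmult_0_r, Rmult_0_l, Rplus_0_l.
      rewrite <- sum_plus. apply sum_eq. intros j Hj.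
      rewrite ecoef_step by exact Hn.
      replace (S k - j)%nat with (S (k - j)) by lia.
      rewrite rough_step by exact Hn.
      replace (S k - S j)%nat with (k - j)%nat by lia.
      replace (z - Z.of_nat (S n) - Z.of_nat (j * n))%Z
        with (z - Z.of_nat (S j * n) - 1)%Z by lia.
      replace (z - Z.of_nat (j * n) - Z.of_nat n)%Z
        with (z - Z.of_nat (S j * n))%Z by lia.
      ring.
Qed.

(* Newton's identities: the elementary symmetric function [e_k] in terms of the power
   sums [d, p2, p3, p4]. *)
Definition newton (k : nat) (d p2 p3 p4 : R) : R :=
  match k with
  | O => 1
  | 1%nat => d
  | 2%nat => d ^ 2 / 2 - p2 / 2
  | 3%nat => d ^ 3 / 6 - p2 * d / 2 + p3 / 3
  | _ => d ^ 4 / 24 - p2 * d ^ 2 / 4 + p3 * d / 3 + p2 ^ 2 / 8 - p4 / 4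
  end.

(** Up to degree 4, [newton k] is the coefficient of w^k in exp(d w - p2 w^2/2 + p3 w^3/3 - p4
    w^4/4). Lowering d by 1/n multiplies this by exp(- w/n), which has the coefficients of
    [rough_cutoff] but no shift of the argument. *)
Lemma newton_taylor (n k : nat) (d p2 p3 p4 : R) : (1 <= n)%nat -> (k <= 4)%nat ->
  newton k (d - / INR n) p2 p3 p4
  = sum_f_R0 (fun j => ecoef n j * newton (k - j) d p2 p3 p4) k.
Proof.
  intros Hn Hk. apply lt_0_INR in Hn. unfold ecoef.
  destruct k as [|[|[|[|[|k]]]]]; [| | | | |lia]; simpl; field; lra.
Qed.

(** For cutoff 1 the recurrence reads e_(k+1)(N+1) - e_(k+1)(N) = e_k(N)/(N+1), the rule for
    adjoining the variable 1/(N+1); the Newton polynomials in the power sums obey the same rule. *)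
Lemma rough_1 (k N : nat) : (k <= 4)%nat ->
  rough 1 k (Z.of_nat N) = newton k (psum 1 N) (psum 2 N) (psum 3 N) (psum 4 N).
Proof.
  revert N. induction k as [|k IHk]; intros N Hk.
  - simpl. destruct (Z.ltb_spec (Z.of_nat N) 0). lia. reflexivity.
  - induction N as [|N IHN].
    + rewrite rough_S_nonpos by lia. unfold psum.
      destruct k as [|[|[|[|k]]]]; [| | | |lia]; simpl; field.
    + assert (Hs := rough_step 1 k (Z.of_nat (S N)) ltac:(lia)).
      replace (Z.of_nat (S N) - Z.of_nat 1)%Z with (Z.of_nat N) in Hs by lia.
      replace (Z.of_nat (S N) - 1)%Z with (Z.of_nat N) in Hs by lia.
      rewrite IHk, IHN in Hs by lia. rewrite <- INR_IZR_INZ in Hs.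
      pose proof (INR_S_ge1 N) as Hx.
      apply (Rmult_eq_reg_l (INR (S N))); [|lra].
      apply (Rplus_eq_reg_r (- (INR (S N) *
         newton (S k) (psum 1 N) (psum 2 N) (psum 3 N) (psum 4 N)))).
      transitivity (newton k (psum 1 N) (psum 2 N) (psum 3 N) (psum 4 N)).
      rewrite <- Hs. ring. clear Hs IHN IHk.
      unfold psum. cbn [sum1].
      destruct k as [|[|[|[|k]]]]; [| | | |lia]; unfold newton; field; lra.
Qed.

Lemma rough_pos (n k : nat) (z : Z) : 0 <= rough n k z.
Proof.
  revert z. induction k as [|k IH]; intros z; cbn [rough].
  - destruct (z <? 0)%Z; lra.
  - change 0 with (sum1 (fun m => rough n k (Z.of_nat m - Z.of_nat n) / INR m) 0).
    apply sum1_nonneg_le; [|lia]. intros m.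
    apply Rmult_le_pos. apply IH. apply inv_INR_nonneg.
Qed.

Lemma psum_1_ge1 (N : nat) : (1 <= N)%nat -> 1 <= psum 1 N.
Proof.
  intros HN. induction HN. unfold psum; simpl; lra.
  eapply Rle_trans. exact IHHN. apply psum_incr.
Qed.

Lemma psum_1_le (N M : nat) : (N <= M)%nat -> psum 1 N <= psum 1 M.
Proof.
  intros H. induction H. lra. eapply Rle_trans. exact IHle. apply psum_incr.
Qed.

(** Replacing the bound on m_1 + ... + m_k by m_i <= N for each i leaves a product of k harmonic
    sums; the factor 1/k! is given away. *)
Lemma rough_le_pow (n k : nat) (z : Z) (N : nat) : (z <= Z.of_nat N)%Z ->
  rough n k z <= psum 1 N ^ k.
Proof.
  revert z. induction k as [|k IH]; intros z Hz.
  - simpl. destruct (z <? 0)%Z; lra.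
  - cbn [rough].
    apply Rle_trans with (sum1 (fun m => psum 1 N ^ k * / INR m ^ 1) (Z.to_nat z)).
    + apply sum1_le. intros m Hm. rewrite pow_1.
      apply Rmult_le_compat_r. apply inv_INR_nonneg. apply IH. lia.
    + rewrite sum1_scal. fold (psum 1 (Z.to_nat z)). rewrite <- tech_pow_Rmult, Rmult_comm.
      apply Rmult_le_compat_r. apply pow_le, psum_pos. apply psum_1_le. lia.
Qed.

Lemma rough_le_pow4 (n k : nat) (z : Z) (N : nat) : (k <= 4)%nat -> (1 <= N)%nat ->
  (z <= Z.of_nat N)%Z -> rough n k z <= psum 1 N ^ 4.
Proof.
  intros Hk HN Hz. eapply Rle_trans. apply rough_le_pow. exact Hz.
  apply Rle_pow. now apply psum_1_ge1. exact Hk.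
Qed.

(** By [rough_step] a unit step down from y changes the value by a lower-degree sum divided by y,
    and y >= c during the whole shift. *)
Lemma rough_shift (n k a : nat) (z : Z) (N : nat) (c : R) :
  (1 <= n)%nat -> (k <= 4)%nat -> (1 <= N)%nat -> (z <= Z.of_nat N)%Z ->
  0 < c <= IZR z - INR a ->
  Rabs (rough n k (z - Z.of_nat a) - rough n k z) <= INR a * (psum 1 N ^ 4 / c).
Proof.
  intros Hn Hk HN Hz. rewrite INR_IZR_INZ.
  assert (HB : 0 <= psum 1 N ^ 4) by apply pow_le, psum_pos.
  induction a as [|a IH]; intros Hc.
  - rewrite Z.sub_0_r, Rminus_diag, Rabs_R0. simpl. lra.
  - rewrite Nat2Z.inj_succ, succ_IZR in *. assert (IH' := IH ltac:(lra)). clear IH.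
    set (y := (z - Z.of_nat a)%Z) in *.
    replace (z - Z.succ (Z.of_nat a))%Z with (y - 1)%Z by lia.
    assert (Hy : IZR y = IZR z - IZR (Z.of_nat a)) by (unfold y; apply minus_IZR).
    assert (Hb : Rabs (rough n k (y - 1) - rough n k y) <= psum 1 N ^ 4 / c).
    { assert (Hic : 0 < / c) by (apply Rinv_0_lt_compat; lra).
      destruct k as [|k].
      - assert (Hy1 : 0 < IZR (y - 1)) by (rewrite minus_IZR; lra).
        apply lt_IZR in Hy1. simpl.
        destruct (Z.ltb_spec (y - 1) 0), (Z.ltb_spec y 0); try lia.
        rewrite Rminus_diag, Rabs_R0. apply Rmult_le_pos; lra.
      - assert (Hs := rough_step n k y Hn).
        assert (Hr := rough_pos n k (y - Z.of_nat n)).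
        assert (Hr2 := rough_le_pow4 n k (y - Z.of_nat n) N ltac:(lia) HN ltac:(lia)).
        rewrite <- Hs in Hr, Hr2.
        rewrite Rabs_minus_sym.
        assert (Hd : 0 <= rough n (S k) y - rough n (S k) (y - 1)) by nra.
        rewrite Rabs_pos_eq by exact Hd.
        apply Rmult_le_reg_r with c. lra.
        unfold Rdiv. rewrite Rmult_assoc, Rinv_l by lra. nra. }
    replace (rough n k (y - 1) - rough n k z)
      with ((rough n k (y - 1) - rough n k y) + (rough n k y - rough n k z)) by ring.
    eapply Rle_trans. apply Rabs_triang. rewrite Rmult_plus_distr_r, Rmult_1_l. lra.
Qed.

Lemma ecoef_le (n j : nat) : (1 <= n)%nat -> Rabs (ecoef n (S j)) <= / INR n.
Proof.
  intros Hn. assert (H1 : 1 <= INR n) by (apply (le_INR 1); exact Hn).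
  assert (Hi : 0 < / INR n <= 1).
  { split. apply Rinv_0_lt_compat; lra. rewrite <- Rinv_1. apply Rinv_le_contravar; lra. }
  unfold ecoef, Rdiv. rewrite Rabs_mult, <- RPow_abs, Rabs_Ropp, (Rabs_pos_eq (/ INR n)) by lra.
  assert (Hf : 1 <= INR (fact (S j))) by (apply (le_INR 1); apply lt_O_fact).
  rewrite Rabs_pos_eq by (apply Rlt_le, Rinv_0_lt_compat; lra).
  assert (/ INR (fact (S j)) <= 1) by (rewrite <- Rinv_1; apply Rinv_le_contravar; lra).
  assert (0 < / INR (fact (S j))) by (apply Rinv_0_lt_compat; lra).
  assert (0 < (/ INR n) ^ j) by (apply pow_lt; lra).
  assert ((/ INR n) ^ j <= 1) by (rewrite <- (pow1 j); apply pow_incr; lra).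
  cbn [pow]. rewrite Rmult_assoc. rewrite <- (Rmult_1_r (/ INR n)) at 3.
  apply Rmult_le_compat_l. lra. nra.
Qed.

(** Induction on the cutoff, exact at n = 1. [rough_cutoff] and [newton_taylor] have the same
    coefficients, so going from n to n + 1 costs only the shifts by jn and the errors of lower
    degree. For j >= 1 the coefficient, at most 1/n, offsets their factor n. At most four such terms
    arise, and 4 (32 5^k + 8) <= 32 5^(k+1) explains the growth 5^k. *)
Lemma rough_newton (n N k : nat) :
  (1 <= n)%nat -> (8 * n <= N)%nat -> (k <= 4)%nat ->
  Rabs (rough n k (Z.of_nat N)
        - newton k (psum 1 N - psum 1 (pred n)) (psum 2 N) (psum 3 N) (psum 4 N))
  <= 32 * 5 ^ k * INR n * (psum 1 N ^ 4 / INR N).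
Proof.
  intros Hn. revert k. induction Hn as [|n Hn IH]; intros k HN Hk.
  - rewrite rough_1 by exact Hk. unfold psum at 5. cbn [sum1 pred].
    rewrite Rminus_0_r, Rminus_diag, Rabs_R0.
    assert (0 < 5 ^ k) by (apply pow_lt; lra).
    assert (0 < INR N) by (apply lt_0_INR; lia).
    assert (0 <= psum 1 N ^ 4 / INR N).
    { apply Rmult_le_pos. apply pow_le, psum_pos. apply inv_INR_nonneg. }
    simpl (INR 1). nra.
  - assert (HN0 : (1 <= N)%nat) by lia.
    set (B := psum 1 N ^ 4 / INR N) in *.
    assert (HB : 0 <= B).
    { apply Rmult_le_pos. apply pow_le, psum_pos. apply inv_INR_nonneg. }
    destruct k as [|k].
    + cbn [rough newton]. rewrite pow_O.
      destruct (Z.ltb_spec (Z.of_nat N) 0). lia. rewrite Rminus_diag, Rabs_R0.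
      assert (0 <= INR (S n)) by apply pos_INR. nra.
    + rewrite rough_cutoff by exact Hn.
      replace (psum 1 N - psum 1 (pred (S n)))
        with ((psum 1 N - psum 1 (pred n)) - / INR n).
      2:{ simpl pred. destruct n as [|n]. lia. unfold psum. cbn [sum1 pred].
          rewrite pow_1. ring. }
      set (d := psum 1 N - psum 1 (pred n)) in *.
      rewrite newton_taylor by (exact Hn || exact Hk).
      rewrite <- minus_sum, decomp_sum by lia. simpl (pred (S k)).
      assert (Hn0 : 0 < INR n) by (apply lt_0_INR; lia).
      assert (HNn : 8 * INR n <= INR N).
      { replace (8 * INR n) with (INR (8 * n)). apply le_INR. lia.
        rewrite mult_INR. simpl. ring. }
      eapply Rle_trans. apply Rabs_triang.
      eapply Rle_trans. apply Rplus_le_compat_l. apply Rsum_abs.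
      eapply Rle_trans.
      { apply Rplus_le_compat_l. apply sum_Rle with (Bn := fun _ => (32 * 5 ^ k + 8) * B).
        intros j Hj. rewrite <- Rmult_minus_distr_l, Rabs_mult.
        replace (S k - S j)%nat with (k - j)%nat by lia.
        assert (H1 := IH (k - j)%nat ltac:(lia) ltac:(lia)).
        assert (H2 : Rabs (rough n (k - j) (Z.of_nat N - Z.of_nat (S j * n))
                        - rough n (k - j) (Z.of_nat N)) <= 8 * INR n * B).
        (* The total shift is at most 4n <= N/2, so the argument stays above N/2. *)
        { eapply Rle_trans. apply rough_shift with (N := N) (c := INR N / 2); try lia.
          rewrite <- INR_IZR_INZ, mult_INR.
          assert (INR (S j) <= 4) by (replace 4 with (INR 4) by (simpl; ring); apply le_INR; lia).
          split. lra. nra.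
          rewrite mult_INR.
          assert (INR (S j) <= 4) by (replace 4 with (INR 4) by (simpl; ring); apply le_INR; lia).
          replace (psum 1 N ^ 4 / (INR N / 2)) with (2 * B) by (unfold B; field; lra).
          assert (0 <= INR n * B) by nra. nra. }
        assert (H3 : 5 ^ (k - j) <= 5 ^ k) by (apply Rle_pow; [lra|lia]).
        assert (H4 : Rabs (rough n (k - j) (Z.of_nat N - Z.of_nat (S j * n))
               - newton (k - j) d (psum 2 N) (psum 3 N) (psum 4 N))
               <= INR n * ((32 * 5 ^ k + 8) * B)).
        { replace (rough n (k - j) (Z.of_nat N - Z.of_nat (S j * n))
               - newton (k - j) d (psum 2 N) (psum 3 N) (psum 4 N))
          with ((rough n (k - j) (Z.of_nat N - Z.of_nat (S j * n))
                        - rough n (k - j) (Z.of_nat N))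
             + (rough n (k - j) (Z.of_nat N)
                 - newton (k - j) d (psum 2 N) (psum 3 N) (psum 4 N))) by ring.
          eapply Rle_trans. apply Rabs_triang.
          assert (0 <= INR n * B) by nra. nra. }
        apply Rle_trans with (/ INR n * (INR n * ((32 * 5 ^ k + 8) * B))).
        apply Rmult_le_compat; try apply Rabs_pos. now apply ecoef_le. exact H4.
        right. field. lra. }
      rewrite sum_cte, <- Rmult_minus_distr_l.
      replace (ecoef n 0) with 1 by (unfold ecoef; simpl; field).
      rewrite Rmult_1_l, Z.sub_0_r, Nat.sub_0_r.
      assert (H1 := IH (S k) ltac:(lia) Hk).
      assert (INR (S k) <= 4) by (replace 4 with (INR 4) by (simpl; ring); apply le_INR; lia).
      assert (H5 : 1 <= 5 ^ k) by (apply pow_R1_Rle; lra).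
      rewrite (S_INR n). rewrite <- tech_pow_Rmult in *.
      assert (0 <= INR (S k)) by apply pos_INR.
      assert ((32 * 5 ^ k + 8) * B * INR (S k) <= (32 * 5 ^ k + 8) * B * 4)
        by (apply Rmult_le_compat_l; nra).
      assert (B <= 5 ^ k * B) by nra. nra.
Qed.

(** * The functions P_k and their asymptotics *)

Lemma is_derive_P_of_continuous (k : nat) (u : R) :
  (forall t, INR k < t -> continuous (fun t => P k (t - 1) / t) t) ->
  INR k < u -> is_derive (P (S k)) u (P k (u - 1) / u).
Proof.
  intros Hc Hu. assert (Heps : 0 < u - INR k) by lra.
  apply (is_derive_RInt (fun t => P k (t - 1) / t) (P (S k)) (INR (S k)) u); [|now apply Hc].
  exists (mkposreal _ Heps). intros b Hb.
  apply (RInt_correct (V := R_CompleteNormedModule)).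
  apply (ex_RInt_continuous (V := R_CompleteNormedModule)).
  intros t [Ht _]. apply Hc. eapply Rlt_le_trans; [|exact Ht].
  change (Rabs (b - u) < u - INR k) in Hb. apply Rabs_def2 in Hb.
  apply Rmin_glb_lt. apply lt_INR; lia. lra.
Qed.

(** Valid already for u > k, where for u < k + 1 the defining integral runs backwards. This slack
    makes starting points such as u = 2 for P_2, and u = 4 in the final identity, interior points.
    In the induction, differentiability of P_k gives the continuity of the next integrand. *)
Lemma is_derive_P (k : nat) (u : R) :
  INR k < u -> is_derive (P (S k)) u (P k (u - 1) / u).
Proof.
  revert u. induction k as [|k IH]; intros u; apply is_derive_P_of_continuous;
    intros t Ht; apply (ex_derive_continuous (fun t => P _ (t - 1) / t)).
  - simpl in Ht |- *. auto_derive. lra.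
  - pose proof (pos_INR k). rewrite S_INR in Ht.
    apply (ex_derive_mult (fun t => P (S k) (t - 1)) (fun t => / t)).
    + apply (ex_derive_comp (P (S k)) (fun t => t - 1)).
      eexists. apply IH. lra. auto_derive. exact I.
    + auto_derive. lra.
Qed.

Lemma P_start (k : nat) : P (S k) (INR (S k)) = 0.
Proof. apply (RInt_point (V := R_CompleteNormedModule)). Qed.

Lemma P_mvt (k : nat) (a b : R) : INR (S k) <= a -> a <= b ->
  exists c, a <= c <= b /\ P (S k) b - P (S k) a = P k (c - 1) / c * (b - a).
Proof.
  intros Ha Hab. rewrite S_INR in Ha.
  destruct (MVT_gen (P (S k)) a b (fun t => P k (t - 1) / t)) as [c [Hc H]].
  - intros x Hx. apply is_derive_P. rewrite Rmin_left in Hx; lra.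
  - intros x Hx. apply derivable_continuous_pt. eexists.
    apply is_derive_Reals, is_derive_P. rewrite Rmin_left in Hx; lra.
  - exists c. rewrite Rmin_left, Rmax_right in Hc by lra. now split.
Qed.

Lemma P_pos (k : nat) (u : R) : INR k <= u -> 0 <= P k u.
Proof.
  revert u. induction k as [|k IH]; intros u Hu. simpl; lra.
  destruct (P_mvt k (INR (S k)) u (Rle_refl _) Hu) as [c [Hc H]].
  rewrite P_start in H. pose proof (pos_INR k). rewrite S_INR in Hc, H.
  assert (0 <= P k (c - 1)) by (apply IH; lra).
  assert (0 <= P k (c - 1) / c).
  { apply Rmult_le_pos. lra. apply Rlt_le, Rinv_0_lt_compat. lra. }
  nra.
Qed.

Lemma P_mono (k : nat) (a b : R) : INR k <= a -> a <= b -> P k a <= P k b.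
Proof.
  intros Ha Hab. destruct k as [|k]. simpl; lra.
  destruct (P_mvt k a b Ha Hab) as [c [Hc H]].
  rewrite S_INR in Ha. pose proof (pos_INR k).
  assert (0 <= P k (c - 1)) by (apply P_pos; lra).
  assert (0 <= P k (c - 1) / c).
  { apply Rmult_le_pos. lra. apply Rlt_le, Rinv_0_lt_compat. lra. }
  nra.
Qed.

Lemma P_incr_bounds (k : nat) (a b : R) : INR (S k) <= a -> a <= b ->
  P k (a - 1) / b * (b - a) <= P (S k) b - P (S k) a <= P k (b - 1) / a * (b - a).
Proof.
  intros Ha Hab. destruct (P_mvt k a b Ha Hab) as [c [Hc H]].
  rewrite H. rewrite S_INR in Ha. pose proof (pos_INR k).
  assert (0 <= P k (a - 1)) by (apply P_pos; lra).
  assert (P k (a - 1) <= P k (c - 1)) by (apply P_mono; lra).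
  assert (P k (c - 1) <= P k (b - 1)) by (apply P_mono; lra).
  assert (0 < / b) by (apply Rinv_0_lt_compat; lra).
  assert (/ b <= / c) by (apply Rinv_le_contravar; lra).
  assert (/ c <= / a) by (apply Rinv_le_contravar; lra).
  split; apply Rmult_le_compat_r; try lra; apply Rmult_le_compat; lra.
Qed.

(** Here k summands, each at least n, cannot fit below kn. Together with [P_start] this gives the
    initial value of the comparison with P_k. *)
Lemma rough_small (n k : nat) (z : Z) : (1 <= n)%nat -> (z < Z.of_nat (k * n))%Z ->
  rough n k z = 0.
Proof.
  intros Hn. revert z. induction k as [|k IH]; intros z Hz.
  - apply rough_neg. lia.
  - cbn [rough].
    rewrite (sum1_ext _ (fun _ => 0)). rewrite sum1_const; ring.
    intros m Hm. rewrite IH by lia. unfold Rdiv. ring.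
Qed.

(* [rough (S n) k N] is a lower Riemann sum, of mesh [1/n], for the [k]-fold integral
   behind [P k (N/n)]; the factor [(1 + 1/n)^k] below comes from
   [1/(m-1) <= (1 + 1/n)/m] for [m > n]. *)
Lemma rough_le_P (n k N : nat) : (1 <= n)%nat -> (k * n <= N)%nat ->
  rough (S n) k (Z.of_nat N) <= P k (INR N / INR n).
Proof.
  intros Hn. assert (Hn0 : 0 < INR n) by (apply lt_0_INR; lia).
  revert N. induction k as [|k IHk]; intros N HN.
  - simpl. destruct (Z.of_nat N <? 0)%Z; lra.
  - induction HN as [|N HN IHN].
    + rewrite rough_small by lia. rewrite mult_INR.
      replace (INR (S k) * INR n / INR n) with (INR (S k)) by (field; lra).
      rewrite P_start. lra.
    + assert (Hs := rough_step (S n) k (Z.of_nat (S N)) ltac:(lia)).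
      replace (Z.of_nat (S N) - 1)%Z with (Z.of_nat N) in Hs by lia.
      replace (Z.of_nat (S N) - Z.of_nat (S n))%Z with (Z.of_nat (N - n)) in Hs by lia.
      rewrite <- INR_IZR_INZ in Hs.
      assert (HP := IHk (N - n)%nat ltac:(lia)).
      rewrite minus_INR in HP by lia.
      assert (HN0 : INR (S k * n) <= INR N) by (apply le_INR; exact HN).
      rewrite mult_INR in HN0.
      assert (HNn : INR (S k) <= INR N / INR n).
      { apply Rmult_le_reg_r with (INR n). lra. unfold Rdiv.
        rewrite Rmult_assoc, Rinv_l by lra. lra. }
      pose proof (INR_S_ge1 N) as HSN.
      assert (HSd : INR (S N) / INR n = INR N / INR n + / INR n) by (rewrite S_INR; field; lra).
      assert (Hin : 0 < / INR n) by now apply Rinv_0_lt_compat.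
      destruct (P_incr_bounds k (INR N / INR n) (INR (S N) / INR n)) as [Hb _]; [lra|lra|].
      replace (INR N / INR n - 1) with ((INR N - INR n) / INR n) in Hb by (field; lra).
      replace (P k ((INR N - INR n) / INR n) / (INR (S N) / INR n) *
         (INR (S N) / INR n - INR N / INR n))
        with (P k ((INR N - INR n) / INR n) / INR (S N)) in Hb
        by (rewrite HSd at 2; field; lra).
      assert (rough (S n) (S k) (Z.of_nat (S N)) - rough (S n) (S k) (Z.of_nat N)
        <= P k ((INR N - INR n) / INR n) / INR (S N)).
      { apply Rmult_le_reg_l with (INR (S N)). lra. rewrite Hs.
        replace (INR (S N) * (P k ((INR N - INR n) / INR n) / INR (S N)))
          with (P k ((INR N - INR n) / INR n)) by (field; lra). exact HP. }
      lra.
Qed.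

Lemma P_le_rough (n k N : nat) : (1 <= n)%nat -> (k * n <= N)%nat ->
  P k (INR N / INR n) <= (1 + / INR n) ^ k * rough n k (Z.of_nat N).
Proof.
  intros Hn. assert (Hn0 : 0 < INR n) by (apply lt_0_INR; lia).
  assert (Hin : 0 < / INR n) by now apply Rinv_0_lt_compat.
  revert N. induction k as [|k IHk]; intros N HN.
  - simpl. destruct (Z.ltb_spec (Z.of_nat N) 0). lia. lra.
  - induction HN as [|N HN IHN].
    + rewrite mult_INR.
      replace (INR (S k) * INR n / INR n) with (INR (S k)) by (field; lra).
      rewrite P_start. apply Rmult_le_pos. apply pow_le; lra. apply rough_pos.
    + assert (Hs := rough_step n k (Z.of_nat (S N)) Hn).
      replace (Z.of_nat (S N) - 1)%Z with (Z.of_nat N) in Hs by lia.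
      replace (Z.of_nat (S N) - Z.of_nat n)%Z with (Z.of_nat (S N - n)) in Hs by lia.
      rewrite <- INR_IZR_INZ in Hs.
      assert (HP := IHk (S N - n)%nat ltac:(lia)).
      rewrite minus_INR in HP by lia.
      assert (HN0 : INR (S k * n) <= INR N) by (apply le_INR; exact HN).
      assert (HnN : INR n <= INR N) by (apply le_INR; lia).
      rewrite mult_INR in HN0.
      assert (HNn : INR (S k) <= INR N / INR n).
      { apply Rmult_le_reg_r with (INR n). lra. unfold Rdiv.
        rewrite Rmult_assoc, Rinv_l by lra. lra. }
      pose proof (INR_S_ge1 N) as HSN.
      assert (HSd : INR (S N) / INR n = INR N / INR n + / INR n) by (rewrite S_INR; field; lra).
      destruct (P_incr_bounds k (INR N / INR n) (INR (S N) / INR n)) as [_ Hb]; [lra|lra|].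
      replace (INR (S N) / INR n - 1) with ((INR (S N) - INR n) / INR n) in Hb by (field; lra).
      replace (P k ((INR (S N) - INR n) / INR n) / (INR N / INR n) *
         (INR (S N) / INR n - INR N / INR n))
        with (P k ((INR (S N) - INR n) / INR n) / INR N) in Hb
        by (rewrite HSd; field; lra).
      set (q := P k ((INR (S N) - INR n) / INR n)) in *.
      set (r0 := rough n (S k) (Z.of_nat N)) in *.
      set (r1 := rough n (S k) (Z.of_nat (S N))) in *.
      assert (Hq : q / INR N <= (1 + / INR n) ^ S k * (r1 - r0)).
      { replace (r1 - r0) with (rough n k (Z.of_nat (S N - n)) / INR (S N))
          by (rewrite <- Hs; field; lra).
        assert (Hr := rough_pos n k (Z.of_nat (S N - n))).
        set (r := rough n k (Z.of_nat (S N - n))) in *.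
        assert (HiN : / INR N <= (1 + / INR n) * / INR (S N)).
        { assert (/ INR N <= / INR n) by (apply Rinv_le_contravar; lra).
          replace (/ INR N) with ((1 + / INR N) * / INR (S N)) by (rewrite S_INR; field; lra).
          apply Rmult_le_compat_r. apply inv_INR_nonneg. lra. }
        apply Rle_trans with (((1 + / INR n) ^ k * r) * / INR N).
        apply Rmult_le_compat_r. apply inv_INR_nonneg. exact HP.
        apply Rle_trans with (((1 + / INR n) ^ k * r) * ((1 + / INR n) * / INR (S N))).
        apply Rmult_le_compat_l. apply Rmult_le_pos. apply pow_le; lra. exact Hr. exact HiN.
        rewrite <- tech_pow_Rmult. unfold Rdiv. right. ring. }
      lra.
Qed.

(** * From harmonic sums to logarithms *)

Lemma ln_le_sub (t : R) : 0 < t -> ln t <= t - 1.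
Proof.
  intros Ht. rewrite <- (ln_exp (t - 1)). apply ln_le. exact Ht.
  pose proof (exp_ineq1_le (t - 1)). lra.
Qed.

Lemma ln_succ_bounds (m : nat) : (1 <= m)%nat ->
  / INR (S m) <= ln (INR (S m)) - ln (INR m) <= / INR m.
Proof.
  intros Hm. apply lt_0_INR in Hm. pose proof (INR_S_ge1 m) as Hs.
  split.
  - assert (H := ln_le_sub (INR m / INR (S m)) ltac:(apply Rdiv_lt_0_compat; lra)).
    rewrite ln_div in H by lra.
    replace (INR m / INR (S m) - 1) with (- / INR (S m)) in H
      by (rewrite S_INR; field; lra). lra.
  - assert (H := ln_le_sub (INR (S m) / INR m) ltac:(apply Rdiv_lt_0_compat; lra)).
    rewrite ln_div in H by lra.
    replace (INR (S m) / INR m - 1) with (/ INR m) in H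
      by (rewrite S_INR; field; lra). lra.
Qed.

Lemma psum_1_upper (n N : nat) : (1 <= n <= N)%nat ->
  psum 1 N - psum 1 n <= ln (INR N) - ln (INR n).
Proof.
  intros [Hn HN]. induction HN as [|N HN IH]. lra.
  pose proof (ln_succ_bounds N ltac:(lia)).
  unfold psum at 1. cbn [sum1]. fold (psum 1 N). rewrite pow_1. lra.
Qed.

Lemma psum_1_lower (n N : nat) : (1 <= n <= N)%nat ->
  ln (INR N) - ln (INR n) <= psum 1 N - psum 1 (pred n).
Proof.
  intros [Hn HN].
  cut (ln (INR (S N)) - ln (INR n) <= psum 1 N - psum 1 (pred n)).
  { pose proof (ln_succ_bounds N ltac:(lia)).
    pose proof (inv_INR_nonneg (S N)). lra. }
  induction HN as [|N HN IH].
  - destruct n as [|n]. lia. pose proof (ln_succ_bounds (S n) ltac:(lia)).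
    unfold psum at 1. cbn [sum1 pred]. fold (psum 1 n). rewrite pow_1. lra.
  - pose proof (ln_succ_bounds (S N) ltac:(lia)).
    unfold psum at 1. cbn [sum1]. fold (psum 1 N). rewrite pow_1. lra.
Qed.

(** As polynomials in the first power sum the two values differ by a multiple of d - L; the witness
    q is the explicit quotient, estimated termwise using M >= 1. *)
Lemma newton_lipschitz (k : nat) (d L M p2 p3 p4 : R) :
  0 <= d <= M -> 0 <= L <= M -> 1 <= M -> 0 <= p2 <= 2 -> 0 <= p3 <= 2 ->
  Rabs (newton k d p2 p3 p4 - newton k L p2 p3 p4) <= 2 * M ^ 4 * Rabs (d - L).
Proof.
  intros Hd HL HM H2 H3.
  assert (HM2 : M <= M ^ 2) by nra.
  assert (HM3 : M ^ 2 <= M ^ 3) by (apply Rle_pow; [lra|lia]).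
  assert (HM4 : M ^ 3 <= M ^ 4) by (apply Rle_pow; [lra|lia]).
  assert (Hq : exists q, Rabs q <= 2 * M ^ 4 /\
     newton k d p2 p3 p4 - newton k L p2 p3 p4 = q * (d - L)).
  { assert (Hd2 : 0 <= d ^ 2 <= M ^ 2) by (split; [apply pow_le; lra|apply pow_incr; lra]).
    assert (HL2 : 0 <= L ^ 2 <= M ^ 2) by (split; [apply pow_le; lra|apply pow_incr; lra]).
    assert (HdL : 0 <= d * L <= M ^ 2) by nra.
    destruct k as [|[|[|[|k]]]].
    - exists 0. rewrite Rabs_R0. simpl. split; [nra|ring].
    - exists 1. rewrite Rabs_R1. simpl. split; [nra|ring].
    - exists ((d + L) / 2). split; [apply Rabs_le; split; lra|simpl; field].
    - exists ((d ^ 2 + d * L + L ^ 2) / 6 - p2 / 2).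
      split; [apply Rabs_le; split; lra|simpl; field].
    - exists ((d + L) * (d ^ 2 + L ^ 2) / 24 - p2 * (d + L) / 4 + p3 / 3).
      split; [|simpl; field].
      assert (0 <= (d + L) * (d ^ 2 + L ^ 2) <= (2 * M) * (2 * M ^ 2)).
      { split. apply Rmult_le_pos; lra. apply Rmult_le_compat; lra. }
      assert (0 <= p2 * (d + L) <= 2 * (2 * M)).
      { split. apply Rmult_le_pos; lra. apply Rmult_le_compat; lra. }
      replace (2 * M * (2 * M ^ 2)) with (4 * M ^ 3) in * by ring.
      apply Rabs_le; split; lra. }
  destruct Hq as [q [Hq1 Hq2]]. rewrite Hq2, Rabs_mult.
  apply Rmult_le_compat_r. apply Rabs_pos. exact Hq1.
Qed.

Lemma one_plus_pow_le (k : nat) (x : R) : (k <= 4)%nat -> 0 <= x <= 1 ->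
  (1 + x) ^ k <= 1 + 15 * x.
Proof.
  intros Hk Hx. apply Rle_trans with ((1 + x) ^ 4). apply Rle_pow; [lra|exact Hk].
  assert (0 <= x * (1 - x)) by nra. assert (0 <= x * (x * (1 - x))) by nra.
  assert (0 <= x * (x * (x * (1 - x)))) by nra. nra.
Qed.

(** For N = n^2 one has log N - log n = log n, so the truncated harmonic sums of [rough_newton] are
    log n up to 1/n. The threshold 9 is the least n with 8 (n + 1) <= n^2, as that lemma requires at
    cutoff n + 1. *)
Lemma harmonic_square (n : nat) : (9 <= n)%nat ->
  9 <= INR n /\ 1 <= psum 1 (n * n) /\ 0 <= ln (INR n) <= psum 1 (n * n) /\
  psum 1 (n * n) - psum 1 n <= ln (INR n) <= psum 1 (n * n) - psum 1 (pred n) /\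
  psum 1 n = psum 1 (pred n) + / INR n /\ psum 1 (n * n) <= 1 + 2 * ln (INR n).
Proof.
  intros Hn.
  assert (H9 : 9 <= INR n) by (replace 9 with (INR 9) by (simpl; ring); now apply le_INR).
  assert (HM : 1 <= psum 1 (n * n)) by (apply psum_1_ge1; nia).
  assert (Hl : ln (INR (n * n)) = 2 * ln (INR n)) by (rewrite mult_INR, ln_mult by lra; ring).
  pose proof (psum_1_upper n (n * n) ltac:(nia)) as H1.
  pose proof (psum_1_lower n (n * n) ltac:(nia)) as H2.
  pose proof (psum_1_upper 1 (n * n) ltac:(nia)) as H3.
  replace (psum 1 1) with 1 in H3 by (unfold psum; simpl; field).
  simpl (INR 1) in H3. rewrite ln_1 in H3. rewrite Hl in *.
  pose proof (psum_pos 1 (pred n)).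
  assert (0 <= ln (INR n)) by (rewrite <- ln_1; apply ln_le; lra).
  assert (psum 1 n = psum 1 (pred n) + / INR n).
  { destruct n as [|m]. lia. unfold psum. cbn [sum1 pred]. now rewrite pow_1. }
  repeat split; lra.
Qed.

Lemma P_le_pow (n k : nat) : (9 <= n)%nat -> (k <= 4)%nat ->
  P k (INR n) <= 16 * psum 1 (n * n) ^ 4.
Proof.
  intros Hn Hk. destruct (harmonic_square n Hn) as [H9 _].
  assert (H := P_le_rough n k (n * n) ltac:(lia) ltac:(nia)).
  rewrite mult_INR in H. replace (INR n * INR n / INR n) with (INR n) in H by (field; lra).
  eapply Rle_trans. exact H.
  assert (Hi : 0 < / INR n <= 1).
  { split. apply Rinv_0_lt_compat; lra. rewrite <- Rinv_1. apply Rinv_le_contravar; lra. }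
  pose proof (one_plus_pow_le k (/ INR n) Hk ltac:(lra)).
  apply Rmult_le_compat. apply pow_le; lra. apply rough_pos. lra.
  apply rough_le_pow4; nia.
Qed.

(** P_k(n) lies between the sums with cutoffs n + 1 and n, up to the factor (1 + 1/n)^k. In units of
    M^4/n the losses are at most 32 5^4 = 20000, doubled for cutoff n + 1, plus 2 for replacing the
    harmonic difference by log n and 15 for that factor. *)
Lemma P_newton (n k : nat) : (9 <= n)%nat -> (k <= 4)%nat ->
  Rabs (P k (INR n)
        - newton k (ln (INR n)) (psum 2 (n * n)) (psum 3 (n * n)) (psum 4 (n * n)))
  <= 50000 * (psum 1 (n * n) ^ 4 / INR n).
Proof.
  intros Hn Hk. destruct (harmonic_square n Hn) as (H9 & HM & HL & Hd & Hp & _).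
  set (M := psum 1 (n * n)) in *.
  set (L := ln (INR n)) in *.
  assert (Hi : 0 < / INR n <= 1).
  { split. apply Rinv_0_lt_compat; lra. rewrite <- Rinv_1. apply Rinv_le_contravar; lra. }
  assert (Hup := P_le_rough n k (n * n) ltac:(lia) ltac:(nia)).
  assert (Hlo := rough_le_P n k (n * n) ltac:(lia) ltac:(nia)).
  rewrite mult_INR in Hup, Hlo.
  replace (INR n * INR n / INR n) with (INR n) in Hup, Hlo by (field; lra).
  assert (Hr1 := rough_newton n (n * n) k ltac:(lia) ltac:(nia) Hk).
  assert (Hr2 := rough_newton (S n) (n * n) k ltac:(lia) ltac:(nia) Hk).
  simpl pred in Hr2.
  assert (Hr := rough_le_pow4 n k (Z.of_nat (n * n)) (n * n) Hk ltac:(nia) ltac:(lia)).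
  assert (Hr0 := rough_pos n k (Z.of_nat (n * n))).
  fold M in Hr, Hr1, Hr2.
  set (p2 := psum 2 (n * n)) in *. set (p3 := psum 3 (n * n)) in *.
  set (p4 := psum 4 (n * n)) in *.
  assert (H2 : 0 <= p2 <= 2) by (split; [apply psum_pos|apply psum_le_2; lia]).
  assert (H3 : 0 <= p3 <= 2) by (split; [apply psum_pos|apply psum_le_2; lia]).
  pose proof (psum_pos 1 (pred n)) as Hpp.
  assert (HnM : psum 1 n <= M) by (apply psum_1_le; nia).
  assert (Hl1 := newton_lipschitz k (M - psum 1 (pred n)) L M p2 p3 p4
     ltac:(lra) HL HM H2 H3).
  assert (Hl2 := newton_lipschitz k (M - psum 1 n) L M p2 p3 p4
     ltac:(lra) HL HM H2 H3).
  assert (HM4 : 0 < M ^ 4) by (apply pow_lt; lra).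
  set (Q := M ^ 4 / INR n).
  assert (HQ : 0 < Q) by (apply Rdiv_lt_0_compat; lra).
  assert (Hb1 : 2 * M ^ 4 * Rabs (M - psum 1 (pred n) - L) <= 2 * Q).
  { unfold Q, Rdiv. rewrite <- Rmult_assoc. apply Rmult_le_compat_l. lra.
    apply Rabs_le; lra. }
  assert (Hb2 : 2 * M ^ 4 * Rabs (M - psum 1 n - L) <= 2 * Q).
  { unfold Q, Rdiv. rewrite <- Rmult_assoc. apply Rmult_le_compat_l. lra.
    apply Rabs_le; lra. }
  assert (H5 : 1 <= 5 ^ k <= 625).
  { split. apply pow_R1_Rle; lra. replace 625 with (5 ^ 4) by ring.
    apply Rle_pow; [lra|exact Hk]. }
  rewrite mult_INR in Hr1, Hr2.
  replace (32 * 5 ^ k * INR n * (M ^ 4 / (INR n * INR n))) with (32 * 5 ^ k * Q) in Hr1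
    by (unfold Q; field; lra).
  replace (32 * 5 ^ k * INR (S n) * (M ^ 4 / (INR n * INR n)))
    with (32 * 5 ^ k * Q * (1 + / INR n)) in Hr2
    by (unfold Q; rewrite S_INR; field; lra).
  assert (H6 : 32 * 5 ^ k * Q <= 20000 * Q) by (apply Rmult_le_compat_r; lra).
  assert (H7 : 32 * 5 ^ k * Q * (1 + / INR n) <= 20000 * Q * 2)
    by (apply Rmult_le_compat; nra).
  assert (H8 : (1 + / INR n) ^ k * rough n k (Z.of_nat (n * n))
     <= rough n k (Z.of_nat (n * n)) + 15 * Q).
  { pose proof (one_plus_pow_le k (/ INR n) Hk ltac:(lra)).
    apply Rle_trans with ((1 + 15 * / INR n) * rough n k (Z.of_nat (n * n))).
    apply Rmult_le_compat_r; lra.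
    unfold Q, Rdiv. nra. }
  apply Rabs_le_between in Hr1. apply Rabs_le_between in Hr2.
  apply Rabs_le_between in Hl1. apply Rabs_le_between in Hl2.
  apply Rabs_le_between. lra.
Qed.

(** In newton 4 - L newton 3 the terms with p3 cancel. Moving P_3 from n to n - 1 costs at most
    P_2(n-1)/(n-1), and replacing p2 by zeta_2 next to L^2 costs L^2/n^2. The terms p2^2/8 and p4/4
    carry no power of L and are left for a plain limit. *)
Lemma P_4_P_3_rate (n : nat) : (9 <= n)%nat ->
  Rabs (P 4 (INR n) - P 3 (INR n - 1) * ln (INR n)
        + ln (INR n) ^ 4 / 8 - zeta 2 / 4 * ln (INR n) ^ 2
        - (psum 2 (n * n) ^ 2 / 8 - psum 4 (n * n) / 4))
  <= 200000 * ((1 + 2 * ln (INR n)) ^ 5 / INR n).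
Proof.
  intros Hn. destruct (harmonic_square n Hn) as (H9 & HM & HL & _ & _ & HML).
  assert (H4 := P_newton n 4 Hn ltac:(lia)). assert (H3 := P_newton n 3 Hn ltac:(lia)).
  assert (H2 := P_le_pow n 2 Hn ltac:(lia)).
  set (M := psum 1 (n * n)) in *.
  assert (Hz := psum_zeta 2 (n * n) ltac:(lia) ltac:(nia)).
  unfold newton in H3, H4.
  set (L := ln (INR n)) in *.
  set (p2 := psum 2 (n * n)) in *. set (p3 := psum 3 (n * n)) in *.
  set (p4 := psum 4 (n * n)) in *.
  assert (Hi : 0 < / INR n <= 1).
  { split. apply Rinv_0_lt_compat; lra. rewrite <- Rinv_1. apply Rinv_le_contravar; lra. }
  assert (Hd : 0 <= P 3 (INR n) - P 3 (INR n - 1) <= 32 * (M ^ 4 / INR n)).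
  { destruct (P_incr_bounds 2 (INR n - 1) (INR n)) as [Ha Hb]; [simpl; lra|lra|].
    replace (INR n - (INR n - 1)) with 1 in * by ring. rewrite Rmult_1_r in *.
    assert (Hm := P_mono 2 (INR n - 1) (INR n) ltac:(simpl; lra) ltac:(lra)).
    assert (Hp := P_pos 2 (INR n - 1 - 1) ltac:(simpl; lra)).
    assert (Hp2 := P_pos 2 (INR n - 1) ltac:(simpl; lra)).
    split.
    - eapply Rle_trans; [|exact Ha]. apply Rmult_le_pos; lra.
    - eapply Rle_trans; [exact Hb|].
      replace (32 * (M ^ 4 / INR n)) with (16 * M ^ 4 * (2 * / INR n)) by (field; lra).
      assert (/ (INR n - 1) <= 2 * / INR n).
      { replace (2 * / INR n) with (/ (INR n / 2)) by (field; lra).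
        apply Rinv_le_contravar; lra. }
      apply Rmult_le_compat; try lra. apply Rlt_le, Rinv_0_lt_compat; lra. }
  set (Q := M ^ 5 / INR n).
  assert (HM45 : M ^ 4 <= M ^ 5) by (apply Rle_pow; [lra|lia]).
  assert (HM4 : 1 <= M ^ 4) by (apply pow_R1_Rle; lra).
  assert (HQ : M ^ 4 / INR n <= Q) by (apply Rmult_le_compat_r; lra).
  assert (HQ0 : 0 < M ^ 4 / INR n) by (apply Rdiv_lt_0_compat; lra).
  assert (HQL : L * (M ^ 4 / INR n) <= Q).
  { unfold Q, Rdiv. rewrite <- Rmult_assoc. apply Rmult_le_compat_r. lra.
    rewrite <- (tech_pow_Rmult M 4). apply Rmult_le_compat_r; lra. }
  assert (H3L : Rabs (L * (P 3 (INR n) - (L ^ 3 / 6 - p2 * L / 2 + p3 / 3))) <= 50000 * Q).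
  { rewrite Rabs_mult, (Rabs_pos_eq L) by lra.
    eapply Rle_trans. apply Rmult_le_compat_l. lra. exact H3. lra. }
  assert (HdL : 0 <= L * (P 3 (INR n) - P 3 (INR n - 1)) <= 32 * Q).
  { split. apply Rmult_le_pos; lra.
    apply Rle_trans with (L * (32 * (M ^ 4 / INR n))). apply Rmult_le_compat_l; lra. lra. }
  assert (HzL : 0 <= (zeta 2 - p2) * L ^ 2 <= Q).
  { assert (HL2 : 0 <= L ^ 2 <= M ^ 5).
    { split. apply pow_le; lra. apply Rle_trans with (M ^ 2). apply pow_incr; lra.
      apply Rle_pow; [lra|lia]. }
    split. apply Rmult_le_pos; lra.
    unfold Q, Rdiv. rewrite Rmult_comm. apply Rmult_le_compat; try lra.
    rewrite mult_INR, Rinv_mult in Hz. nra. }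
  assert (HQM : Q <= (1 + 2 * L) ^ 5 / INR n).
  { apply Rmult_le_compat_r. lra. apply pow_incr. lra. }
  apply Rle_trans with (200000 * Q); [|lra].
  apply Rabs_le_between in H4. apply Rabs_le_between in H3L. apply Rabs_le_between.
  nra.
Qed.

(** With s = sqrt x, apply t <= exp t to t = -(log s)/m and raise to the power m: (-log s)^m <= m^m
    / s. Then x = s^2 and log x = 2 log s give the constant (2m)^m. *)
Lemma ln_pow_sqrt (m : nat) (x : R) : (1 <= m)%nat -> 0 < x <= 1 ->
  0 <= x * (- ln x) ^ m <= (2 * INR m) ^ m * sqrt x.
Proof.
  intros Hm Hx. apply lt_0_INR in Hm.
  assert (Hl : ln x <= 0) by (rewrite <- ln_1; apply ln_le; lra).
  assert (Hs : 0 < sqrt x) by (apply sqrt_lt_R0; lra).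
  assert (Hss : sqrt x * sqrt x = x) by (apply sqrt_sqrt; lra).
  split. apply Rmult_le_pos. lra. apply pow_le. lra.
  set (s := sqrt x) in *.
  assert (Hls : ln x = 2 * ln s) by (rewrite <- Hss, ln_mult by lra; ring).
  assert (He : (- ln s) ^ m <= INR m ^ m * / s).
  { replace (/ s) with (exp (- ln s / INR m) ^ m).
    - rewrite <- Rpow_mult_distr. apply pow_incr. split. lra.
      pose proof (exp_ineq1_le (- ln s / INR m)).
      replace (- ln s) with (INR m * (- ln s / INR m)) at 1 by (field; lra).
      apply Rmult_le_compat_l; lra.
    - rewrite <- Rpower_pow by apply exp_pos. unfold Rpower. rewrite ln_exp.
      replace (INR m * (- ln s / INR m)) with (- ln s) by (field; lra).
      rewrite exp_Ropp, exp_ln; lra. }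
  rewrite Hls. replace (- (2 * ln s)) with (2 * (- ln s)) by ring.
  rewrite !Rpow_mult_distr, <- Hss.
  assert (0 < 2 ^ m) by (apply pow_lt; lra).
  replace (2 ^ m * INR m ^ m * s) with (s * s * (2 ^ m * (INR m ^ m * / s))) by (field; lra).
  apply Rmult_le_compat_l. nra. apply Rmult_le_compat_l; lra.
Qed.

Lemma is_lim_seq_sqrt_inv (c : R) : is_lim_seq (fun n => c * sqrt (/ INR n)) 0.
Proof.
  replace (Finite 0) with (Rbar_mult c (sqrt 0)) by (simpl; rewrite sqrt_0, Rmult_0_r; reflexivity).
  apply is_lim_seq_scal_l.
  apply (is_lim_seq_continuous sqrt (fun n => / INR n) 0).
  apply continuity_pt_sqrt. lra.
  replace (Finite 0) with (Rbar_inv p_infty) by reflexivity.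
  apply is_lim_seq_inv. apply is_lim_seq_INR. discriminate.
Qed.

Lemma is_lim_seq_sqrt_rate (u : nat -> R) (l c : R) (N : nat) :
  (forall n, (N <= n)%nat -> Rabs (u n - l) <= c * sqrt (/ INR n)) -> is_lim_seq u l.
Proof.
  intros H. apply is_lim_seq_ext with (fun n => (u n - l) + l). intros n. ring.
  replace (Finite l) with (Finite (0 + l)) by (f_equal; ring).
  apply is_lim_seq_plus'; [|apply is_lim_seq_const].
  apply is_lim_seq_abs_0.
  apply is_lim_seq_le_le_loc with (fun _ => 0) (fun n => c * sqrt (/ INR n)).
  - exists N. intros n Hn. split. apply Rabs_pos. now apply H.
  - apply is_lim_seq_const.
  - apply is_lim_seq_sqrt_inv.
Qed.

Lemma inv_le_sqrt_inv (n : nat) : (1 <= n)%nat ->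
  0 < / INR n <= sqrt (/ INR n) /\ ln (INR n) * / INR n <= 2 * sqrt (/ INR n).
Proof.
  intros Hn. assert (H1 : 1 <= INR n) by (apply (le_INR 1); exact Hn).
  assert (Hi : 0 < / INR n <= 1).
  { split. apply Rinv_0_lt_compat; lra. rewrite <- Rinv_1. apply Rinv_le_contravar; lra. }
  assert (Hs : sqrt (/ INR n) * sqrt (/ INR n) = / INR n) by (apply sqrt_sqrt; lra).
  assert (Hs1 : sqrt (/ INR n) <= 1) by (rewrite <- sqrt_1; apply sqrt_le_1; lra).
  assert (Hs0 := sqrt_pos (/ INR n)).
  repeat split. lra. nra.
  destruct (ln_pow_sqrt 1 (/ INR n) ltac:(lia) Hi) as [_ H].
  rewrite ln_Rinv in H by lra. simpl in H. lra.
Qed.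

Lemma P_4_P_3_lim :
  is_lim_seq (fun n => P 4 (INR n) - P 3 (INR n - 1) * ln (INR n)
        + ln (INR n) ^ 4 / 8 - zeta 2 / 4 * ln (INR n) ^ 2)
    (zeta 2 ^ 2 / 8 - zeta 4 / 4).
Proof.
  assert (Hsub : forall k, (2 <= k)%nat -> is_lim_seq (fun n => psum k (n * n)) (zeta k)).
  { intros k Hk. apply (is_lim_seq_subseq (psum k) (zeta k) (fun n => (n * n)%nat)).
    - apply eventually_subseq. intros n. nia.
    - now apply psum_lim. }
  pose (v := fun n => psum 2 (n * n) ^ 2 / 8 - psum 4 (n * n) / 4).
  assert (Hv : is_lim_seq v (zeta 2 ^ 2 / 8 - zeta 4 / 4)).
  { apply is_lim_seq_ext with
      (fun n => psum 2 (n * n) * psum 2 (n * n) * / 8 - psum 4 (n * n) * / 4).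
    intros n. unfold v. field.
    replace (zeta 2 ^ 2 / 8) with (zeta 2 * zeta 2 * / 8) by field.
    apply is_lim_seq_minus'; apply is_lim_seq_mult'; try apply is_lim_seq_const.
    apply is_lim_seq_mult'; apply Hsub; lia. apply Hsub; lia. }
  match goal with |- is_lim_seq ?f _ => set (w := f) end.
  assert (Hd : is_lim_seq (fun n => w n - v n) 0).
  (* From (1 + 2L)^5 <= 3^5 (1 + L^5), separately for L <= 1 and L > 1; the 10^5 is (2m)^m at m =
     5. *)
  { apply is_lim_seq_sqrt_rate with (200000 * 243 * (1 + 10 ^ 5)) 9%nat. intros n Hn.
    rewrite Rminus_0_r. eapply Rle_trans. apply P_4_P_3_rate. exact Hn.
    destruct (harmonic_square n Hn) as (H9 & _ & HL & _).
    destruct (inv_le_sqrt_inv n ltac:(lia)) as [Hs _].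
    set (L := ln (INR n)) in *.
    assert (Hi : 0 < / INR n <= 1).
    { split. apply Rinv_0_lt_compat; lra. rewrite <- Rinv_1. apply Rinv_le_contravar; lra. }
    assert (Hb := ln_pow_sqrt 5 (/ INR n) ltac:(lia) Hi).
    rewrite ln_Rinv in Hb by lra. fold L in Hb. rewrite Ropp_involutive in Hb.
    replace (2 * INR 5) with 10 in Hb by (simpl; ring).
    assert (Hp : (1 + 2 * L) ^ 5 <= 243 + 243 * L ^ 5).
    { assert (0 <= L ^ 5) by (apply pow_le; lra).
      destruct (Rle_dec L 1).
      - apply Rle_trans with (3 ^ 5). apply pow_incr; lra. lra.
      - apply Rle_trans with ((3 * L) ^ 5). apply pow_incr; lra.
        rewrite Rpow_mult_distr. lra. }
    assert ((1 + 2 * L) ^ 5 / INR n <= (243 + 243 * L ^ 5) * / INR n)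
      by (apply Rmult_le_compat_r; lra).
    lra. }
  apply is_lim_seq_ext with (fun n => (w n - v n) + v n).
  intros n. ring.
  replace (zeta 2 ^ 2 / 8 - zeta 4 / 4) with (0 + (zeta 2 ^ 2 / 8 - zeta 4 / 4)) by ring.
  apply is_lim_seq_plus'. exact Hd. exact Hv.
Qed.

(** * The dilogarithm and P_2 *)

Lemma Li_partial_lim (k : nat) (x : R) : (2 <= k)%nat -> 0 <= x <= 1 ->
  is_lim_seq (sum1 (fun m => x ^ m / INR m ^ k)) (Li k x).
Proof.
  intros Hk Hx. apply is_lim_seq_incr_1.
  apply is_lim_seq_ext with (sum_n (fun n => x ^ S n / INR (S n) ^ k)).
  intros n. apply (sum_n_sum1 (fun m => x ^ m / INR m ^ k)).
  apply (Series_correct (fun n => x ^ S n / INR (S n) ^ k)).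
  apply (ex_series_le (V := R_CompleteNormedModule)) with (fun n => 1 ^ S n / INR (S n) ^ k).
  - intros n. change norm with Rabs.
    assert (0 <= x ^ S n <= 1 ^ S n) by (split; [apply pow_le; lra|apply pow_incr; lra]).
    pose proof (coefLi_bounds k n) as Hc. unfold coefLi in Hc.
    rewrite Rabs_pos_eq. apply Rmult_le_compat_r; lra. apply Rmult_le_pos; lra.
  - now apply psum_lim.
Qed.

Lemma bernoulli_le (x : R) (m : nat) : 0 <= x <= 1 -> 0 <= 1 - x ^ m <= INR m * (1 - x).
Proof.
  intros Hx. induction m as [|m IH]. simpl; lra.
  rewrite S_INR, <- tech_pow_Rmult. nra.
Qed.

(* A quantitative form of Abel's theorem: cut the series at [N] and use
   [1 - x^m <= m (1 - x)] below the cut. *)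
Lemma zeta_2_sub_Li_2 (x : R) (N : nat) : 0 <= x <= 1 -> (1 <= N)%nat ->
  0 <= zeta 2 - Li 2 x <= (1 - x) * psum 1 N + / INR N.
Proof.
  intros Hx HN.
  assert (L : is_lim_seq (fun M => psum 2 M - sum1 (fun m => x ^ m / INR m ^ 2) M)
                (zeta 2 - Li 2 x)).
  { apply is_lim_seq_minus'. apply psum_lim; lia. now apply Li_partial_lim. }
  assert (Hd : forall M, psum 2 M - sum1 (fun m => x ^ m / INR m ^ 2) M
     = sum1 (fun m => (1 - x ^ m) * / INR m ^ 2) M).
  { intros M. unfold psum.
    replace (sum1 (fun m => / INR m ^ 2) M - sum1 (fun m => x ^ m / INR m ^ 2) M)
      with (sum1 (fun m => / INR m ^ 2) M + (- (1)) * sum1 (fun m => x ^ m / INR m ^ 2) M) by ring.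
    rewrite <- sum1_scal, <- sum1_plus. apply sum1_ext. intros m _. unfold Rdiv. ring. }
  assert (Hpos : forall m, 0 <= (1 - x ^ m) * / INR m ^ 2).
  { intros m. apply Rmult_le_pos. now apply bernoulli_le.
    rewrite <- pow_inv. apply pow_le, inv_INR_nonneg. }
  split.
  - apply (is_lim_seq_le (fun _ => 0) _ 0 (zeta 2 - Li 2 x)) with (2 := is_lim_seq_const 0) (3 := L).
    intros M. rewrite Hd. apply (sum1_nonneg_le _ 0 M Hpos). lia.
  - apply (is_lim_seq_le_loc _ (fun _ => (1 - x) * psum 1 N + / INR N)
       (zeta 2 - Li 2 x) ((1 - x) * psum 1 N + / INR N)) with (2 := L) (3 := is_lim_seq_const _).
    exists N. intros M HM. rewrite Hd.
    replace M with (N + (M - N))%nat by lia. rewrite sum1_add.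
    apply Rplus_le_compat.
    + unfold psum. rewrite <- sum1_scal. apply sum1_le. intros m [Hm _].
      apply lt_0_INR in Hm. pose proof (bernoulli_le x m Hx).
      replace ((1 - x) * / INR m ^ 1) with (INR m * (1 - x) * / INR m ^ 2) by (field; lra).
      apply Rmult_le_compat_r. apply Rlt_le, Rinv_0_lt_compat, pow_lt; lra. lra.
    + apply Rle_trans with (sum1 (fun m => / INR (N + m) ^ 2) (M - N)).
      * apply sum1_le. intros m Hm.
        assert (0 <= x ^ (N + m)) by (apply pow_le; lra).
        assert (0 <= / INR (N + m) ^ 2) by (rewrite <- pow_inv; apply pow_le, inv_INR_nonneg).
        nra.
      * pose proof (sum1_add (fun m => / INR m ^ 2) N (M - N)) as Ha.
        replace (N + (M - N))%nat with M in Ha by lia.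
        pose proof (psum_2_tail_le 2 N M ltac:(lia) ltac:(lia)) as Ht. unfold psum in Ht.
        pose proof (inv_INR_nonneg M). lra.
Qed.

(** Cutting the series at N = n in the Abel estimate gives an error of at most (2 + log n)/n. *)
Lemma Li_2_near_1 (n : nat) : (1 <= n)%nat ->
  Rabs (Li 2 (1 - / INR n) - zeta 2) <= 4 * sqrt (/ INR n).
Proof.
  intros Hn. destruct (inv_le_sqrt_inv n Hn) as [Hi HL].
  assert (H1 : 1 <= INR n) by (apply (le_INR 1); exact Hn).
  assert (Hi1 : / INR n <= 1) by (rewrite <- Rinv_1; apply Rinv_le_contravar; lra).
  assert (H := zeta_2_sub_Li_2 (1 - / INR n) n ltac:(lra) Hn).
  assert (Hh := psum_1_upper 1 n ltac:(lia)). simpl (INR 1) in Hh. rewrite ln_1 in Hh.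
  replace (psum 1 1) with 1 in Hh by (unfold psum; simpl; field).
  replace (1 - (1 - / INR n)) with (/ INR n) in H by ring.
  assert (/ INR n * psum 1 n <= / INR n * (1 + ln (INR n))) by (apply Rmult_le_compat_l; lra).
  apply Rabs_le_between. lra.
Qed.

(** The left side has derivative 0 on (0, 1); its value is read off along x = 1/n, where Li_2(1/n)
    and the product of logarithms vanish in the limit. *)
Lemma Li_2_reflection (x : R) : 0 < x < 1 ->
  Li 2 x + Li 2 (1 - x) + ln x * ln (1 - x) = zeta 2.
Proof.
  intros Hx. set (f := fun x => Li 2 x + Li 2 (1 - x) + ln x * ln (1 - x)).
  change (f x = zeta 2).
  assert (Hc : forall a b, 0 < a < 1 -> 0 < b < 1 -> f a = f b).
  { intros a b Ha Hb. apply derive_zero_eq. intros t Ht.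
    assert (Ht1 : 0 < t < 1).
    { split. eapply Rlt_le_trans; [|apply Ht]. apply Rmin_glb_lt; lra.
      eapply Rle_lt_trans; [apply Ht|]. apply Rmax_lub_lt; lra. }
    assert (H1 := is_derive_Li 1 t ltac:(rewrite Rabs_pos_eq; lra) ltac:(lra)).
    assert (H2 := is_derive_Li 1 (1 - t) ltac:(rewrite Rabs_pos_eq; lra) ltac:(lra)).
    rewrite Li_1 in H1 by (rewrite Rabs_pos_eq; lra).
    rewrite Li_1 in H2 by (rewrite Rabs_pos_eq; lra).
    unfold f. auto_derive.
    - repeat split; try lra; eexists; [exact H1|exact H2].
    - rewrite (is_derive_unique _ _ _ H1 : Derive (fun x => Li 2 x) t = _).
      replace (1 + - t) with (1 - t) by ring.
      rewrite (is_derive_unique _ _ _ H2 : Derive (fun x => Li 2 x) (1 - t) = _).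
      replace (1 - (1 - t)) with t by ring. field. lra. }
  assert (L : is_lim_seq (fun _ : nat => f x) (zeta 2)).
  { apply is_lim_seq_sqrt_rate with (10) 2%nat. intros n Hn.
    destruct (inv_le_sqrt_inv n ltac:(lia)) as [Hi HL].
    assert (H2 : 2 <= INR n) by (apply (le_INR 2); exact Hn).
    assert (Hi2 : / INR n <= 1 / 2).
    { replace (1 / 2) with (/ 2) by field. apply Rinv_le_contravar; lra. }
    rewrite (Hc x (/ INR n)) by lra. unfold f.
    assert (A1 := Li_2_near_1 n ltac:(lia)).
    assert (A2 := Li_linear_bound 2 (/ INR n)).
    rewrite (Rabs_pos_eq (/ INR n)) in A2 by lra. specialize (A2 Hi2).
    assert (A3 : 0 <= - ln (1 - / INR n) <= 2 * / INR n).
    { split. assert (H := ln_le_sub (1 - / INR n) ltac:(lra)). lra.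
      rewrite <- ln_Rinv by lra.
      eapply Rle_trans. apply ln_le_sub. apply Rinv_0_lt_compat; lra.
      apply Rle_trans with (/ INR n * / (1 - / INR n)).
      right. field. lra.
      assert (/ (1 - / INR n) <= / (1 / 2)) by (apply Rinv_le_contravar; lra).
      replace (/ (1 / 2)) with 2 in * by field. nra. }
    assert (HL0 : 0 <= ln (INR n)) by (rewrite <- ln_1; apply ln_le; lra).
    rewrite ln_Rinv by lra.
    assert (A4 : 0 <= - ln (INR n) * ln (1 - / INR n) <= 4 * sqrt (/ INR n)).
    { replace (- ln (INR n) * ln (1 - / INR n)) with (ln (INR n) * - ln (1 - / INR n)) by ring.
      split. apply Rmult_le_pos; lra.
      apply Rle_trans with (ln (INR n) * (2 * / INR n)). apply Rmult_le_compat_l; lra. lra. }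
    apply Rabs_le_between in A1. apply Rabs_le_between in A2. apply Rabs_le_between. lra. }
  apply is_lim_seq_unique in L. rewrite Lim_seq_const in L. now injection L.
Qed.

Lemma P_1 (u : R) : 0 < u -> P 1 u = ln u.
Proof.
  intros Hu. cut (P 1 u - ln u = P 1 1 - ln 1).
  { rewrite (P_start 0 : P 1 1 = 0), ln_1. lra. }
  apply (derive_zero_eq (fun t => P 1 t - ln t)). intros t Ht.
  assert (Ht0 : 0 < t) by (eapply Rlt_le_trans; [|apply Ht]; apply Rmin_glb_lt; lra).
  assert (H := is_derive_P 0 t Ht0). simpl in H. change (is_derive (P 1) t (1 / t)) in H.
  revert H. generalize (P 1). intros p H. auto_derive.
  - repeat split; [eexists; exact H|lra].
  - rewrite (is_derive_unique _ _ _ H : Derive (fun x => p x) t = _). field. lra.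
Qed.

Lemma P_2 (u : R) : 1 < u -> P 2 u = ln u ^ 2 / 2 + Li 2 (1 / u) - zeta 2 / 2.
Proof.
  intros Hu.
  cut (P 2 u - (ln u ^ 2 / 2 + Li 2 (/ u)) = P 2 2 - (ln 2 ^ 2 / 2 + Li 2 (/ 2))).
  (* The constant is fixed at u = 2: reflection at 1/2 gives 2 Li_2(1/2) = zeta_2 - log^2 2. *)
  { assert (H := Li_2_reflection (/ 2) ltac:(lra)).
    replace (1 - / 2) with (/ 2) in H by field. rewrite ln_Rinv in H by lra.
    rewrite (P_start 1 : P 2 2 = 0).
    replace (1 / u) with (/ u) by (field; lra). lra. }
  apply (derive_zero_eq (fun t => P 2 t - (ln t ^ 2 / 2 + Li 2 (/ t)))). intros t Ht.
  assert (Ht1 : 1 < t) by (eapply Rlt_le_trans; [|apply Ht]; apply Rmin_glb_lt; lra).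
  assert (Hi : 0 < / t < 1).
  { split. apply Rinv_0_lt_compat; lra. rewrite <- Rinv_1. apply Rinv_lt_contravar; lra. }
  assert (H := is_derive_P 1 t Ht1). rewrite P_1 in H by lra.
  assert (H2 := is_derive_Li 1 (/ t) ltac:(rewrite Rabs_pos_eq; lra) ltac:(lra)).
  rewrite Li_1 in H2 by (rewrite Rabs_pos_eq; lra).
  replace (1 - / t) with ((t - 1) / t) in H2 by (field; lra).
  rewrite ln_div in H2 by lra.
  revert H. generalize (P 2). intros p H. auto_derive.
  - repeat split; try lra; eexists; [exact H|exact H2].
  - rewrite (is_derive_unique _ _ _ H : Derive (fun x => p x) t = _).
    rewrite (is_derive_unique _ _ _ H2 : Derive (fun x => Li 2 x) (/ t) = _).
    field. lra.
Qed.

(** * The functions E_4 and H_4 *)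

(** E_4 comes from integrating log^3(y)/(2y(1+y)) by parts repeatedly: each derivative of a
    polylogarithm cancels against that of the neighbouring power of log y, and only (log^3 y /
    2)(1/y - 1/(1+y)) is left. *)
Lemma is_derive_E4 (y : R) : 0 < y < 1 ->
  is_derive E4 y (ln y ^ 3 / (2 * (y * (1 + y)))).
Proof.
  intros Hy.
  assert (Ha : Rabs (- y) < 1) by (rewrite Rabs_Ropp, Rabs_pos_eq; lra).
  assert (H4 := is_derive_Li 3 (- y) Ha ltac:(lra)).
  assert (H3 := is_derive_Li 2 (- y) Ha ltac:(lra)).
  assert (H2 := is_derive_Li 1 (- y) Ha ltac:(lra)).
  assert (H1 := is_derive_Li_1 (- y) Ha).
  unfold E4. auto_derive.
  - repeat split; try lra; eexists; [exact H4|exact H3|exact H2|exact H1].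
  - rewrite (is_derive_unique _ _ _ H4 : Derive (fun x => Li 4 x) (- y) = _).
    rewrite (is_derive_unique _ _ _ H3 : Derive (fun x => Li 3 x) (- y) = _).
    rewrite (is_derive_unique _ _ _ H2 : Derive (fun x => Li 2 x) (- y) = _).
    rewrite (is_derive_unique _ _ _ H1 : Derive (fun x => Li 1 x) (- y) = _).
    field. lra.
Qed.

(* The integrand of [H4] with [Li 1 (-2x)] in closed form, which is smooth across
   [x = 1/2], where the defining series stops converging. *)
Definition H4_closed (x : R) : R :=
  ((ln x - ln (1 + 2 * x)) * Li 2 x - ln x ^ 2 * ln (1 + 2 * x) / 2) / (x * (1 + x)).

Lemma H4_integrand_closed (x : R) : 0 < x < 1 / 2 -> H4_integrand x = H4_closed x.
Proof.
  intros Hx. unfold H4_integrand, H4_closed.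
  rewrite Li_1 by (rewrite Rabs_Ropp, Rabs_pos_eq; lra).
  rewrite ln_div by lra. replace (1 - - (2 * x)) with (1 + 2 * x) by ring. field. lra.
Qed.

(* The substitution [x = t^2] removes the logarithmic singularity at [0]. *)
Definition H4_subst (t : R) : R := 2 * t * H4_closed (t ^ 2).

(** Both Li_2(x) and log(1+2x) are at most 2x, which removes the pole of 1/(x(1+x)) and leaves
    powers of log; the factor 2t then wins. With [ln_pow_sqrt] the three terms contribute 16 + 4 +
    128 <= 200. *)
Lemma H4_subst_bound (t : R) : Rabs t <= 1 / 2 ->
  Rabs (H4_subst t) <= 200 * sqrt (Rabs t).
Proof.
  intros Ht. destruct (Req_dec t 0) as [E|Hn0].
  { unfold H4_subst. rewrite E, Rmult_0_r, Rmult_0_l, !Rabs_R0, sqrt_0. lra. }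
  assert (Hs : 0 < Rabs t) by now apply Rabs_pos_lt.
  assert (Hl1 := ln_pow_sqrt 1 (Rabs t) ltac:(lia) ltac:(lra)).
  assert (Hl2 := ln_pow_sqrt 2 (Rabs t) ltac:(lia) ltac:(lra)).
  simpl (INR _) in Hl1, Hl2.
  assert (Hss : sqrt (Rabs t) * sqrt (Rabs t) = Rabs t) by (apply sqrt_sqrt; lra).
  assert (Hs1 : sqrt (Rabs t) <= 1) by (rewrite <- sqrt_1; apply sqrt_le_1; lra).
  assert (Hs0 := sqrt_pos (Rabs t)).
  unfold H4_subst. rewrite <- (pow2_abs t), Rabs_mult, Rabs_mult, (Rabs_pos_eq 2) by lra.
  set (s := Rabs t) in *. set (m := - ln s) in *.
  set (x := s ^ 2). assert (Hx : 0 < x <= 1 / 4) by (unfold x; nra).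
  assert (Hlx : ln x = - (2 * m)) by (unfold x, m; simpl; rewrite Rmult_1_r, ln_mult by lra; ring).
  assert (Hm : 0 <= m).
  { unfold m. assert (ln s <= ln 1) by (apply ln_le; lra). rewrite ln_1 in *. lra. }
  assert (Hb : 0 <= ln (1 + 2 * x) <= 2 * x).
  { split. rewrite <- ln_1. apply ln_le; lra.
    eapply Rle_trans. apply ln_le_sub. lra. lra. }
  assert (HLi := Li_linear_bound 2 x). rewrite (Rabs_pos_eq x) in HLi by lra.
  specialize (HLi ltac:(lra)).
  assert (Hc : Rabs (H4_closed x) <= 4 * m + 2 + 4 * m ^ 2).
  { unfold H4_closed, Rdiv. rewrite Hlx, Rabs_mult, (Rabs_pos_eq (/ _))
      by (apply Rlt_le, Rinv_0_lt_compat; nra).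
    apply Rmult_le_reg_r with (x * (1 + x)). nra.
    rewrite Rmult_assoc, Rinv_l, Rmult_1_r by nra.
    assert (H1 : Rabs ((- (2 * m) - ln (1 + 2 * x)) * Li 2 x) <= (2 * m + 1) * (2 * x)).
    { rewrite Rabs_mult. apply Rmult_le_compat; try apply Rabs_pos; [|exact HLi].
      apply Rabs_le_between. lra. }
    assert (H2 : 0 <= (- (2 * m)) ^ 2 * ln (1 + 2 * x) * / 2 <= 4 * m ^ 2 * x).
    { replace ((- (2 * m)) ^ 2 * ln (1 + 2 * x) * / 2)
        with (2 * m ^ 2 * ln (1 + 2 * x)) by field.
      assert (0 <= m ^ 2) by (apply pow_le; lra). nra. }
    apply Rabs_le_between in H1.
    assert (0 <= (4 * m + 2 + 4 * m ^ 2) * x * x).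
    { apply Rmult_le_pos; [apply Rmult_le_pos|]; nra. }
    apply Rabs_le_between. lra. }
  apply Rle_trans with (2 * s * (4 * m + 2 + 4 * m ^ 2)).
  apply Rmult_le_compat_l; lra. simpl in *. nra.
Qed.

Lemma ex_derive_H4_closed (x : R) : 0 < x < 1 -> ex_derive H4_closed x.
Proof.
  intros Hx. unfold H4_closed. auto_derive.
  repeat split; try lra.
  eexists. apply is_derive_Li; [rewrite Rabs_pos_eq|]; lra.
  apply Rmult_integral_contrapositive; lra.
Qed.

Lemma continuous_H4_subst (t : R) : Rabs t < 1 -> continuous H4_subst t.
Proof.
  intros Ht. destruct (Req_dec t 0) as [E|Hn0].
  - subst t. apply filterlim_locally. intros eps.
    assert (H0 : H4_subst 0 = 0) by (unfold H4_subst; ring).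
    set (d := eps / 200). assert (Hd : 0 < d) by (destruct eps; unfold d; simpl; lra).
    assert (Hdel : 0 < Rmin (1 / 2) (d ^ 2)) by (apply Rmin_glb_lt; [lra|apply pow_lt; lra]).
    exists (mkposreal _ Hdel). intros t Hb.
    change (Rabs (t - 0) < Rmin (1 / 2) (d ^ 2)) in Hb. rewrite Rminus_0_r in Hb.
    change (Rabs (H4_subst t - H4_subst 0) < eps). rewrite H0, Rminus_0_r.
    assert (Hb1 : Rabs t < 1 / 2) by (eapply Rlt_le_trans; [exact Hb|apply Rmin_l]).
    assert (Hb2 : Rabs t < d ^ 2) by (eapply Rlt_le_trans; [exact Hb|apply Rmin_r]).
    eapply Rle_lt_trans. apply H4_subst_bound. lra.
    assert (sqrt (Rabs t) < d).
    { rewrite <- (sqrt_pow2 d) by lra. apply sqrt_lt_1. apply Rabs_pos. apply pow_le; lra.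
      exact Hb2. }
    unfold d in *. lra.
  - apply (ex_derive_continuous H4_subst). unfold H4_subst.
    apply (ex_derive_mult (fun t => 2 * t) (fun t => H4_closed (t ^ 2))).
    auto_derive. exact I.
    apply (ex_derive_comp H4_closed (fun t => t ^ 2)).
    + apply ex_derive_H4_closed. rewrite <- pow2_abs.
      assert (0 < Rabs t) by now apply Rabs_pos_lt. nra.
    + auto_derive. exact I.
Qed.

Definition H4_prim (s : R) : R := RInt H4_subst 0 s.

Lemma is_derive_H4_prim (s : R) : Rabs s < 1 -> is_derive H4_prim s (H4_subst s).
Proof.
  intros Hs. apply (is_derive_RInt H4_subst H4_prim 0 s); [|now apply continuous_H4_subst].
  assert (Heps : 0 < 1 - Rabs s) by lra.
  exists (mkposreal _ Heps). intros b Hb. change (Rabs (b - s) < 1 - Rabs s) in Hb.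
  apply (RInt_correct (V := R_CompleteNormedModule)).
  apply (ex_RInt_continuous (V := R_CompleteNormedModule)).
  intros t Ht. apply continuous_H4_subst.
  assert (Hb1 : Rabs b < 1).
  { replace b with ((b - s) + s) by ring. eapply Rle_lt_trans. apply Rabs_triang. lra. }
  apply Rabs_def2 in Hb1. apply Rabs_def1.
  eapply Rle_lt_trans. apply Ht. apply Rmax_lub_lt; lra.
  eapply Rlt_le_trans; [|apply Ht]. apply Rmin_glb_lt; lra.
Qed.

Definition H4_smooth (y : R) : R := H4_prim (sqrt y).

Lemma is_derive_H4_smooth (y : R) : 0 < y < 1 ->
  is_derive H4_smooth y (H4_closed y).
Proof.
  intros Hy. assert (Hs : 0 < sqrt y) by (apply sqrt_lt_R0; lra).
  assert (Hs1 : sqrt y < 1) by (rewrite <- sqrt_1; apply sqrt_lt_1; lra).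
  assert (H := is_derive_H4_prim (sqrt y) ltac:(rewrite Rabs_pos_eq; lra)).
  unfold H4_smooth. auto_derive.
  - repeat split; [eexists; exact H|lra].
  - rewrite (is_derive_unique _ _ _ H : Derive (fun x => H4_prim x) (sqrt y) = _).
    unfold H4_subst. rewrite pow2_sqrt by lra. field. lra.
Qed.

Lemma continuous_H4_smooth_0 : continuous H4_smooth 0.
Proof.
  (* [sqrt] is 0 on the negative axis, so the continuity at 0 is two-sided. *)
  apply (continuous_comp sqrt H4_prim). apply continuous_sqrt.
  apply (ex_derive_continuous H4_prim). rewrite sqrt_0.
  eexists. apply is_derive_H4_prim. rewrite Rabs_R0. lra.
Qed.

Lemma H4_smooth_0 : H4_smooth 0 = 0.
Proof. unfold H4_smooth. rewrite sqrt_0. apply (RInt_point (V := R_CompleteNormedModule)). Qed.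

(** Fundamental theorem for the improper integral, with primitive [H4_smooth] tending to 0 at 0+.
    The integrands are compared on open intervals only, so for y = 1/2 the value of [Li 1] at -1, on
    the circle of convergence, is never asked for. *)
Lemma H4_eq (y : R) : 0 < y <= 1 / 2 -> H4 y = H4_smooth y.
Proof.
  intros Hy.
  assert (HD : forall x, 0 < x < 1 -> Derive H4_smooth x = H4_closed x).
  { intros x Hx. apply is_derive_unique. now apply is_derive_H4_smooth. }
  assert (Hnear : filter_prod (at_right 0) (at_point y)
    (fun ab => 0 < fst ab < y /\ snd ab = y)).
  { apply Filter_prod with (fun a => 0 < a < y) (fun b => b = y).
    - exists (mkposreal y (proj1 Hy)). intros a Ha Ha0.
      change (Rabs (a - 0) < y) in Ha. apply Rabs_def2 in Ha. lra.
    - reflexivity.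
    - intros a b Ha Hb. now split. }
  apply is_RInt_gen_unique.
  apply is_RInt_gen_ext with (Derive H4_smooth).
  { apply filter_imp with (2 := Hnear). intros [a b] [Ha Hb] x Hx. simpl in *. subst b.
    rewrite Rmin_left, Rmax_right in Hx by lra.
    rewrite HD by lra. symmetry. apply H4_integrand_closed. lra. }
  replace (H4_smooth y) with (H4_smooth y - 0) by ring.
  apply is_RInt_gen_Derive.
  - apply filter_imp with (2 := Hnear). intros [a b] [Ha Hb] x Hx. simpl in *. subst b.
    rewrite Rmin_left, Rmax_right in Hx by lra.
    eexists. apply is_derive_H4_smooth. lra.
  - apply filter_imp with (2 := Hnear). intros [a b] [Ha Hb] x Hx. simpl in *. subst b.
    rewrite Rmin_left, Rmax_right in Hx by lra.
    apply (continuous_ext_loc _ H4_closed).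
    + assert (Heps : 0 < Rmin x (1 - x)) by (apply Rmin_glb_lt; lra).
      exists (mkposreal _ Heps). intros z Hz. change (Rabs (z - x) < Rmin x (1 - x)) in Hz.
      assert (H1 := Rmin_l x (1 - x)). assert (H2 := Rmin_r x (1 - x)).
      apply Rabs_def2 in Hz. symmetry. apply HD. lra.
    + apply (ex_derive_continuous H4_closed), ex_derive_H4_closed. lra.
  - assert (Hc := continuous_H4_smooth_0). unfold continuous in Hc.
    rewrite H4_smooth_0 in Hc. unfold at_right.
    apply filterlim_filter_le_1 with (2 := Hc). apply filter_le_within.
  - intros Q [eps HQ]. apply HQ. apply ball_center.
Qed.

(** * The constant of integration *)

(** Each |Li_k(-y)| is at most 2y and beats the accompanying power of log y; [ln_pow_sqrt] with
    exponents 1, 2, 3 gives the constants 2, 16, 216, for a total of 6 + 12 + 48 + 216 <= 300. *)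
Lemma E4_near_0 (y : R) : 0 < y <= 1 / 2 ->
  Rabs (E4 y - (19 / 16 * zeta 4 + 1 / 8 * ln y ^ 4)) <= 300 * sqrt y.
Proof.
  intros Hy.
  assert (HLi : forall k, Rabs (Li k (- y)) <= 2 * y).
  { intros k. assert (H := Li_linear_bound k (- y)).
    rewrite Rabs_Ropp, (Rabs_pos_eq y) in H by lra. apply H. lra. }
  assert (Hl : ln y <= 0) by (rewrite <- ln_1; apply ln_le; lra).
  assert (Hk : forall k j c, (1 <= j)%nat -> (2 * INR j) ^ j <= c ->
     Rabs (Li k (- y) * ln y ^ j) <= 2 * c * sqrt y).
  { intros k j c Hj Hc. assert (H := ln_pow_sqrt j y Hj ltac:(lra)).
    rewrite Rabs_mult, <- RPow_abs, (Rabs_left1 (ln y)) by exact Hl.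
    assert (0 <= (- ln y) ^ j) by (apply pow_le; lra).
    assert (0 <= sqrt y) by apply sqrt_pos.
    apply Rle_trans with (2 * y * (- ln y) ^ j).
    apply Rmult_le_compat_r; [lra|apply HLi].
    assert ((2 * INR j) ^ j * sqrt y <= c * sqrt y) by (apply Rmult_le_compat_r; lra).
    lra. }
  assert (H4 := HLi 4%nat).
  assert (H3 := Hk 3%nat 1%nat 2 ltac:(lia) ltac:(simpl; lra)).
  assert (H2 := Hk 2%nat 2%nat 16 ltac:(lia) ltac:(simpl; lra)).
  assert (H1 := Hk 1%nat 3%nat 216 ltac:(lia) ltac:(simpl; lra)).
  rewrite pow_1 in H3.
  assert (Hs : y <= sqrt y).
  { assert (Hss : sqrt y * sqrt y = y) by (apply sqrt_sqrt; lra).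
    assert (sqrt y <= 1) by (rewrite <- sqrt_1; apply sqrt_le_1; lra).
    assert (0 <= sqrt y) by apply sqrt_pos. nra. }
  unfold E4.
  apply Rabs_le_between in H1. apply Rabs_le_between in H2.
  apply Rabs_le_between in H3. apply Rabs_le_between in H4.
  apply Rabs_le_between. lra.
Qed.

Definition defect (u : R) : R :=
  P 4 u - (P 3 (u - 1) * ln u + zeta 2 / 4 * (2 * Li 2 (1 - / u) + ln u ^ 2)
           - E4 (/ (u - 2)) - H4_smooth (/ (u - 2))).

(** The product rule on P_3(u-1) log u cancels P_4', leaving P_2(u-2) log(u)/(u-1). The substitution
    gives dy/(y(1+y)) = -du/(u-1) and log(1+2y) = log u + log y. Hence the log^3 y terms of E_4 and
    H_4 cancel, and their remainder removes all of P_2(u-2) but -zeta_2/2. That part is the negative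
    of the derivative of the explicit zeta_2 term. *)
Lemma is_derive_defect (u : R) : 3 < u -> is_derive defect u 0.
Proof.
  intros Hu.
  assert (H4 := is_derive_P 3 u ltac:(simpl; lra)).
  assert (H3 := is_derive_P 2 (u - 1) ltac:(simpl; lra)).
  rewrite P_2 in H3 by lra. replace (u - 1 - 1) with (u - 2) in H3 by ring.
  replace (1 / (u - 2)) with (/ (u - 2)) in H3 by (field; lra).
  set (y := / (u - 2)) in *.
  assert (Hy : 0 < y < 1).
  { unfold y. split. apply Rinv_0_lt_compat; lra. rewrite <- Rinv_1. apply Rinv_lt_contravar; lra. }
  assert (Hlu : ln (u - 2) = - ln y) by (unfold y; rewrite ln_Rinv; lra).
  assert (Hl1 : ln (1 + 2 * y) = ln u + ln y).
  { unfold y. rewrite <- ln_mult by (try apply Rinv_0_lt_compat; lra). f_equal. field. lra. }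
  rewrite Hlu in H3.
  assert (Hi : 0 < / u < 1).
  { split. apply Rinv_0_lt_compat; lra. rewrite <- Rinv_1. apply Rinv_lt_contravar; lra. }
  assert (HL := is_derive_Li 1 (1 - / u) ltac:(rewrite Rabs_pos_eq; lra) ltac:(lra)).
  rewrite Li_1 in HL by (rewrite Rabs_pos_eq; lra).
  replace (1 - (1 - / u)) with (/ u) in HL by ring. rewrite ln_Rinv in HL by lra.
  assert (HE := is_derive_E4 y Hy).
  assert (HH := is_derive_H4_smooth y Hy).
  unfold H4_closed in HH. rewrite Hl1 in HH.
  unfold defect.
  revert H4 H3 HE HH.
  generalize (P 4) (P 3) E4 H4_smooth. intros p4 p3 e4 h4 H4 H3 HE HH.
  auto_derive.
  - replace (u + - (1)) with (u - 1) by ring. replace (u + - (2)) with (u - 2) by ring.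
    repeat split; try lra; eexists; [exact H4|exact H3|exact HL|exact HE|exact HH].
  - replace (u + - (1)) with (u - 1) by ring. replace (u + - (2)) with (u - 2) by ring.
    replace (1 + - / u) with (1 - / u) by ring. fold y.
    rewrite (is_derive_unique _ _ _ H4 : Derive (fun x => p4 x) u = _).
    rewrite (is_derive_unique _ _ _ H3 : Derive (fun x => p3 x) (u - 1) = _).
    rewrite (is_derive_unique _ _ _ HL : Derive (fun x => Li 2 x) (1 - / u) = _).
    rewrite (is_derive_unique _ _ _ HE : Derive (fun x => e4 x) y = _).
    rewrite (is_derive_unique _ _ _ HH : Derive (fun x => h4 x) y = _).
    generalize (ln y) (ln u) (Li 2 y). intros. unfold y. field. lra.
Qed.

Lemma defect_lim : is_lim_seq (fun n => defect (INR n)) 0.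
Proof.
  set (y := fun n => / (INR n - 2)).
  assert (Hn4 : forall n, (4 <= n)%nat -> 4 <= INR n).
  { intros n Hn. replace 4 with (INR 4) by (simpl; ring). now apply le_INR. }
  assert (Hy : forall n, (4 <= n)%nat -> 0 < y n <= 1 / 2 /\ y n <= 2 * / INR n).
  { intros n Hn. specialize (Hn4 n Hn). unfold y.
    replace (1 / 2) with (/ 2) by field.
    replace (2 * / INR n) with (/ (INR n / 2)) by (field; lra).
    repeat split. apply Rinv_0_lt_compat; lra.
    apply Rinv_le_contravar; lra. apply Rinv_le_contravar; lra. }
  assert (Hys : forall n, (4 <= n)%nat -> sqrt (y n) <= 2 * sqrt (/ INR n)).
  { intros n Hn. destruct (Hy n Hn) as [H1 H2].
    assert (0 < / INR n) by (apply Rinv_0_lt_compat; specialize (Hn4 n Hn); lra).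
    apply Rle_trans with (sqrt (2 * 2 * / INR n)). apply sqrt_le_1; lra.
    rewrite sqrt_mult, sqrt_square by lra. lra. }
  assert (L1 := P_4_P_3_lim).
  assert (L2 : is_lim_seq (fun n => zeta 2 / 2 * Li 2 (1 - / INR n)) (zeta 2 / 2 * zeta 2)).
  { apply is_lim_seq_mult'. apply is_lim_seq_const.
    apply is_lim_seq_sqrt_rate with 4 1%nat. exact Li_2_near_1. }
  assert (L3 : is_lim_seq (fun n => E4 (y n) - 1 / 8 * ln (INR n) ^ 4) (19 / 16 * zeta 4)).
  (* 600 is 300 sqrt(y) with sqrt(y) <= 2 sqrt(1/n); 432 = (16/8) 216 pays for replacing log(n-2) by
     log n in the fourth power. *)
  { apply is_lim_seq_sqrt_rate with (600 + 432) 4%nat. intros n Hn.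
    destruct (Hy n Hn) as [H1 H2]. specialize (Hys n Hn). specialize (Hn4 n Hn).
    assert (HE := E4_near_0 (y n) H1).
    assert (Hi : 0 < / INR n <= 1).
    { split. apply Rinv_0_lt_compat; lra. rewrite <- Rinv_1. apply Rinv_le_contravar; lra. }
    assert (Hp := ln_pow_sqrt 3 (/ INR n) ltac:(lia) Hi).
    rewrite ln_Rinv in Hp by lra. rewrite Ropp_involutive in Hp.
    replace ((2 * INR 3) ^ 3) with 216 in Hp by (simpl; ring).
    assert (Hl : ln (y n) = - ln (INR n - 2)) by (unfold y; rewrite ln_Rinv; lra).
    assert (Hl0 : 0 <= ln (INR n - 2)) by (rewrite <- ln_1; apply ln_le; lra).
    assert (Hl1 : ln (INR n - 2) <= ln (INR n)) by (apply ln_le; lra).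
    assert (Hl2 : ln (INR n) - ln (INR n - 2) <= 2 * y n).
    { rewrite <- ln_div by lra. eapply Rle_trans. apply ln_le_sub. apply Rdiv_lt_0_compat; lra.
      right. unfold y. field. lra. }
    rewrite Hl in HE. set (a := ln (INR n - 2)) in *. set (b := ln (INR n)) in *.
    assert (Hab : 0 <= b ^ 4 - a ^ 4 <= 16 * (/ INR n * b ^ 3)).
    { replace (b ^ 4 - a ^ 4) with ((b - a) * ((a + b) * (a ^ 2 + b ^ 2))) by ring.
      assert (0 <= a ^ 2 <= b ^ 2) by (split; [apply pow_le; lra|apply pow_incr; lra]).
      assert (0 <= (a + b) * (a ^ 2 + b ^ 2) <= (2 * b) * (2 * b ^ 2)).
      { split. apply Rmult_le_pos; lra. apply Rmult_le_compat; lra. }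
      split. apply Rmult_le_pos; lra.
      apply Rle_trans with ((4 * / INR n) * (2 * b * (2 * b ^ 2))).
      apply Rmult_le_compat; lra. right; ring. }
    replace ((- a) ^ 4) with (a ^ 4) in HE by ring.
    apply Rabs_le_between in HE. apply Rabs_le_between. lra. }
  assert (L4 : is_lim_seq (fun n => H4_smooth (y n)) 0).
  { rewrite <- H4_smooth_0.
    apply (is_lim_seq_continuous H4_smooth y 0).
    apply continuity_pt_filterlim. exact continuous_H4_smooth_0.
    apply is_lim_seq_sqrt_rate with 2 4%nat. intros n Hn.
    destruct (Hy n Hn) as [H1 H2]. destruct (inv_le_sqrt_inv n ltac:(lia)) as [H3 _].
    rewrite Rminus_0_r, Rabs_pos_eq; lra. }
  apply is_lim_seq_ext with (fun n =>
    (P 4 (INR n) - P 3 (INR n - 1) * ln (INR n)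
        + ln (INR n) ^ 4 / 8 - zeta 2 / 4 * ln (INR n) ^ 2)
    - zeta 2 / 2 * Li 2 (1 - / INR n)
    + ((E4 (y n) - 1 / 8 * ln (INR n) ^ 4) + H4_smooth (y n))).
  { intros n. unfold defect, y. field. }
  replace 0 with (zeta 2 ^ 2 / 8 - zeta 4 / 4 - zeta 2 / 2 * zeta 2 + (19 / 16 * zeta 4 + 0)).
  { apply is_lim_seq_plus'; [apply is_lim_seq_minus'|apply is_lim_seq_plus']; assumption. }
  (* The constants add up to -(3/8) zeta_2^2 + (15/16) zeta_4. *)
  assert (H := zeta_2_square). lra.
Qed.

Theorem theorem5 (u : R) (hu : 4 <= u) :
  let y := 1 / (u - 2) in
  P 4 u = P 3 (u - 1) * ln u
          + zeta 2 / 4 * (2 * Li 2 (1 - 1 / u) + (ln u) ^ 2)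
          - E4 y - H4 y.
Proof.
  intros y.
  (* Any segment joining u to an integer n >= 4 stays in u > 3, so the sampled values all equal
     [defect u] and their limit is that number. *)
  assert (L : is_lim_seq (fun _ : nat => defect u) 0).
  { apply is_lim_seq_ext_loc with (2 := defect_lim). exists 4%nat. intros n Hn.
    apply (le_INR 4) in Hn. simpl (INR 4) in Hn.
    apply derive_zero_eq. intros t Ht. apply is_derive_defect.
    eapply Rlt_le_trans; [|apply Ht]. apply Rmin_glb_lt; lra. }
  apply is_lim_seq_unique in L. rewrite Lim_seq_const in L. injection L as L.
  assert (Hy : 0 < y <= 1 / 2).
  { unfold y, Rdiv. rewrite !Rmult_1_l. split. apply Rinv_0_lt_compat; lra.
    apply Rinv_le_contravar; lra. }
  rewrite H4_eq by exact Hy.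
  unfold defect in L. unfold y, Rdiv in *. rewrite !Rmult_1_l. lra.
Qed.
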